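(* Let $s\in\mathbb{R}^m$ be such that $|s|_{\ell_1}<1$. Then the limit $$\mathrm{ent}^{\mathrm{per}}(s):=\lim_{n\to\infty}\mathrm{ent}_n(s)$$ exists and defines the local surface tension $\mathrm{ent}^{\mathrm{per}}(s)$. For $|s|_{\ell_1}=1$ one defines $\mathrm{ent}^{\mathrm{per}}(s):=0$.
   Context: $m\ge2$. In $\mathbb{Z}^m$, $x\sim y$ means $|x-y|_{\ell_1}=1$; $\vec i_1,\dots,\vec i_m$ are the standard basis vectors. The $d$-regular rooted tree $\mathcal T$, with graph distance $d_{\mathcal T}$, is identified with the Cayley graph of $G=\langle\alpha_1,\dots,\alpha_d\mid\alpha_1^2=\dots=\alpha_d^2=e\rangle$ generated by the $\alpha_i$, the root $\mathbf r$ being the identity, so that neighbouring vertices $w,w'$ satisfy $w'=\alpha_iw$ for a unique $i$. A map $h:\mathbb{Z}^m\to\mathcal T$ is a graph homomorphism if $d_{\mathcal T}(h(x),h(y))=1$ whenever $x\sim y$; its dual map is $\tilde h(e_{xy})=\alpha_i$, where $x\sim y$ and $\alpha_i$ is the unique generator with $h(y)=\alpha_ih(x)$ ($e_{xy}$ is the oriented edge from $x$ to $y$). $h$ is $n$-translation invariant if $\tilde h(e_{xy})=\tilde h(e_{(x+n\vec i_k)(y+n\vec i_k)})$ for all $x\sim y$ and $k\in\{1,\dots,m\}$. The slope of such an $h$ is $(s_1,\dots,s_m)$ with $s_k=\frac1n\min_{x\in\mathbb{Z}^m}d_{\mathcal T}(h(x),h(x+n\vec i_k))$. A two-sided geodesic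 is a one-to-one graph homomorphism $\mathbf g:\mathbb{Z}\to\mathcal T$; $\Pi_{\mathbf g}:\mathcal T\to\mathbf g$ is the projection onto it. An $n$-translation invariant $h$ is supported on $\mathbf g$ if $d_{\mathcal T}(h(x),\mathbf g)\le\frac{mn}2$ for all $x\in\mathbb{Z}^m$ (if the slope is nonzero there is exactly one such two-sided geodesic). Let $\mathbf g$ be a periodic two-sided geodesic (its sequence of edge colours $\alpha_i$ is periodic), parametrized with $\mathbf g(0)=\mathbf r$. For $s\in[-1,1]^m$ with $|s|_{\ell_1}<1$, $\mathcal H^{\mathbf g}_n(s)$ is the set of $n$-translation invariant graph homomorphisms $h:\mathbb{Z}^m\to\mathcal T$ with slope $\big(\frac{\lfloor s_1n\rfloor}n,\dots,\frac{\lfloor s_mn\rfloor}n\big)$, supported on $\mathbf g$, such that $\Pi_{\mathbf g}(h(0))=\mathbf g(0)$ if $d_{\mathcal T}(h(0),\Pi_{\mathbf g}(h(0)))$ is even and $\Pi_{\mathbf g}(h(0))=\mathbf g(1)$ otherwise. The microscopic surface tension is $\mathrm{ent}_n(s)=-\frac1{n^m}\ln|\mathcal H^{\mathbf g}_n(s)|$; it does not depend on the choice of $\mathbf g$.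
   Formalization: The limit is taken only over those n for which H_n^g(s) is nonempty: over all n it fails (for s = 0, H_n is empty for every odd n); since the slope as defined is nonnegative, nothing is asserted about the limit when some s_k < 0. *)

(* Defs.v *)
From HB Require Import structures.
From mathcomp Require Import all_boot all_order all_algebra.
From mathcomp Require Import all_classical all_reals all_analysis.

Set Implicit Arguments.
Unset Strict Implicit.
Unset Printing Implicit Defensive.

Import Order.TTheory GRing.Theory Num.Theory.

Local Open Scope classical_set_scope.
Local Open Scope ring_scope.

(* In G = <alpha_1, ..., alpha_d | alpha_i^2 = e> every element has a unique
   reduced expression, a word alpha_(i_1) ... alpha_(i_k) with no two equal
   consecutive letters.  The elements of G are represented by these words. *)
Definition reduced (d : nat) (w : seq 'I_d) : bool :=
  sorted (fun i j => i != j) w.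

Definition vertex (d : nat) := {w : seq 'I_d | reduced w}.

Definition tree_root (d : nat) : vertex d :=
  exist (fun w : seq 'I_d => reduced w) [::] isT.

(* Left multiplication by the generator alpha_i, on reduced words. *)
Definition lmul_word (d : nat) (i : 'I_d) (w : seq 'I_d) : seq 'I_d :=
  if w is j :: w' then (if i == j then w' else i :: w) else [:: i].

Lemma lmul_word_reduced (d : nat) (i : 'I_d) (w : seq 'I_d) :
  reduced w -> reduced (lmul_word i w).
Proof.
case: w => [|j w] //= rw; case: eqP => [_|/eqP nij].
  exact: path_sorted rw.
by rewrite /reduced /= nij.
Qed.

Definition lmul (d : nat) (i : 'I_d) (w : vertex d) : vertex d :=
  exist (fun w : seq 'I_d => reduced w) (lmul_word i (val w))
    (lmul_word_reduced i (valP w)).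

Lemma lmulK (d : nat) (i : 'I_d) : involutive (@lmul d i).
Proof.
move=> [w rw]; apply: val_inj => /=.
case: w rw => [|j w] //= rw; first by rewrite eqxx.
case: (eqVneq i j) => [->|_] /=; last by rewrite eqxx.
case: w rw => [|k w] //= /andP[jk _].
by rewrite (negbTE jk).
Qed.

(* A walk is determined by its starting point and the successive generators. *)
Definition has_walk (d : nat) (u v : vertex d) (k : nat) : bool :=
  [exists p : k.-tuple 'I_d, foldr (@lmul d) u p == v].

Lemma has_walk_ex (d : nat) (u v : vertex d) : exists k, has_walk u v k.
Proof.
have toroot (w : seq 'I_d) (rw : reduced w) :
    foldr (@lmul d) (tree_root d) w = exist (fun w => reduced w) w rw.
  elim: w rw => [|i w IH] rw; first exact: val_inj.
  rewrite /= (IH (path_sorted rw)); apply: val_inj => /=.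
  by case: w rw {IH} => [|j w] //= /andP[/negbTE->].
have revwalk (p : seq 'I_d) (x : vertex d) :
    foldr (@lmul d) (foldr (@lmul d) x p) (rev p) = x.
  elim: p x => [|i p IH] x //=.
  by rewrite rev_cons foldr_rcons lmulK IH.
case: u v => [u ru] [v rv]; exists (size (v ++ rev u)).
apply/existsP; exists (in_tuple (v ++ rev u)); apply/eqP => /=.
by rewrite foldr_cat -(toroot u ru) revwalk toroot.
Qed.

Definition tdist (d : nat) (u v : vertex d) : nat := ex_minn (has_walk_ex u v).

(* The generator alpha_i with w' = alpha_i w; [None] if w, w' are not
   neighbours. *)
Definition colour (d : nat) (w w' : vertex d) : option 'I_d :=
  [pick i | w' == lmul i w].

Definition two_sided_geodesic (d : nat) (g : int -> vertex d) : Prop :=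
  injective g /\
  forall i j : int, `|i - j| = 1 -> tdist (g i) (g j) = 1%N.

Definition periodic_geodesic (d : nat) (g : int -> vertex d) : Prop :=
  exists2 p : nat, (0 < p)%N &
    forall j : int,
      colour (g (j + p%:Z)) (g (j + p%:Z + 1)) = colour (g j) (g (j + 1)).

Lemma geod_dist_ex (d : nat) (g : int -> vertex d) (w : vertex d) :
  exists k, `[< exists j, tdist w (g j) = k >].
Proof. by exists (tdist w (g 0)); apply/asboolP; exists 0. Qed.

Definition geod_dist (d : nat) (g : int -> vertex d) (w : vertex d) : nat :=
  ex_minn (geod_dist_ex g w).

(* Nearest-point projection; in a tree the nearest point is unique. *)
Definition geod_proj (d : nat) (g : int -> vertex d) (w : vertex d) : vertex d :=
  xget (g 0) [set v | range g v /\ tdist w v = geod_dist g w].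

Definition l1norm (K : numDomainType) (m : nat) (v : 'rV[K]_m) : K :=
  \sum_(k < m) `|v 0 k|.

Definition lattice_adj (m : nat) (x y : 'rV[int]_m) : Prop :=
  l1norm (x - y) = 1.

Definition graph_hom (m d : nat) (h : 'rV[int]_m -> vertex d) : Prop :=
  forall x y, lattice_adj x y -> tdist (h x) (h y) = 1%N.

Definition dual_map (m d : nat) (h : 'rV[int]_m -> vertex d)
    (x y : 'rV[int]_m) : option 'I_d :=
  colour (h x) (h y).

Definition lattice_shift (m n : nat) (k : 'I_m) (x : 'rV[int]_m) : 'rV[int]_m :=
  x + delta_mx 0 k *+ n.

Definition translation_invariant (m d n : nat) (h : 'rV[int]_m -> vertex d) :
    Prop :=
  forall x y, lattice_adj x y -> forall k : 'I_m,
    dual_map h x y = dual_map h (lattice_shift n k x) (lattice_shift n k y).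

Lemma shift_dist_ex (m d n : nat) (h : 'rV[int]_m -> vertex d) (k : 'I_m) :
  exists l, `[< exists x, tdist (h x) (h (lattice_shift n k x)) = l >].
Proof. by exists (tdist (h 0) (h (lattice_shift n k 0))); apply/asboolP; exists 0. Qed.

Definition min_shift_dist (m d n : nat) (h : 'rV[int]_m -> vertex d)
    (k : 'I_m) : nat :=
  ex_minn (shift_dist_ex n h k).

Definition slope (R : realType) (m d n : nat) (h : 'rV[int]_m -> vertex d) :
    'rV[R]_m :=
  \row_k ((min_shift_dist n h k)%:R / n%:R).

Definition floor_slope (R : realType) (m n : nat) (s : 'rV[R]_m) : 'rV[R]_m :=
  \row_k ((Num.floor (s 0 k * n%:R))%:~R / n%:R).

Definition supported_on (m d n : nat) (g : int -> vertex d)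
    (h : 'rV[int]_m -> vertex d) : Prop :=
  forall x, (geod_dist g (h x))%:R <= (m * n)%:R / 2 :> rat.

Definition Hset (R : realType) (m d : nat) (g : int -> vertex d)
    (s : 'rV[R]_m) (n : nat) : set ('rV[int]_m -> vertex d) :=
  [set h | [/\ graph_hom h,
               translation_invariant n h,
               slope R n h = floor_slope n s,
               supported_on n g h &
               geod_proj g (h 0) =
                 if odd (tdist (h 0) (geod_proj g (h 0))) then g 1 else g 0]].

(* [counting] is the number of elements and [lne] the extended logarithm, so
   that [ent g s n] is +oo when [Hset g s n] is empty; finiteness of [Hset g s n]
   is not presupposed. *)
Definition ent (R : realType) (m d : nat) (g : int -> vertex d)
    (s : 'rV[R]_m) (n : nat) : \bar R :=
  (- ((n%:R ^+ m)^-1%:E * lne (counting (Hset g s n))))%E.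

(* The sizes n at which ln |Hset g s n| makes sense.  They are not all large n:
   the tree is bipartite, hence the distance from h(x) to h(x + n i_k) has the
   parity of n, and Hset is empty as soon as floor (s_k n) and n differ in
   parity for some k (for s = 0, at every odd n); likewise, for large n, when
   some floor (s_k n) is not a multiple of the period of g. *)
Definition admissible (R : realType) (m d : nat) (g : int -> vertex d)
    (s : 'rV[R]_m) : set nat :=
  [set n | Hset g s n !=set0].

(* Main.v *)
(* A tree with a distinguished end carries a parent map (one step towards the
   end) and a height (the Busemann function).  McShane's formula for the height
   lifts to the tree: if f is defined on a set A of lattice points, respects
   parity and does not increase distances, then sending x to the ancestor of
   f(y) in generation |x - y|, for y in A where this ancestor is highest, is a
   well-defined graph homomorphism extending f, and it is equivariant when A
   and f are.

   For n admissible and large the right translations h(x) -> h(x + n i_k) are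
   translations along g by floor(s_k n), forwards or backwards, because an orbit
   at bounded distance from g must end up on g and g is periodic.  In
   coordinates along g the set H_n^g(s) becomes a set of homomorphisms into one
   model tree, the same for all g.

   There the numbers (1/n^m) ln |H_n(s)| are almost increasing in n: by the
   pigeonhole principle a fraction exp(-O(n^(m-1))) of H_n(s) agrees on the
   hyperplanes x_k = 0 mod n, hence K^m cells can be filled independently with
   such maps; the resulting map on a box of side Kn <= (1 - delta) N extends
   N-periodically with slope floor(s N)/N by McShane's formula, since the
   slopes are smaller than 1 and leave room in the margin delta N.  An almost
   increasing bounded sequence converges. *)
Require Import Defs.
From HB Require Import structures.
From mathcomp Require Import all_boot all_order all_algebra.
From mathcomp Require Import fingroup perm.
From mathcomp Require Import all_classical all_reals all_analysis.
From mathcomp Require Import zify ring lra.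
Import Order.TTheory GRing.Theory Num.Theory.
Import numFieldNormedType.Exports.
Local Open Scope classical_set_scope.
Local Open Scope ring_scope.
Set Implicit Arguments.
Unset Strict Implicit.
Unset Printing Implicit Defensive.

Local Notation e_ := (delta_mx 0).

(** * The lattice: distance, unit steps and parity *)

Definition l1dist (m : nat) (x y : 'rV[int]_m) : nat :=
  (\sum_(k < m) `|x 0%R k - y 0%R k|)%N.

Lemma basisE (m : nat) (k i : 'I_m) : (e_ k : 'rV[int]_m) 0 i = (i == k)%:R.
Proof. by rewrite mxE eqxx. Qed.

Lemma l1dist_sym (m : nat) (x y : 'rV[int]_m) : l1dist x y = l1dist y x.
Proof. by apply: eq_bigr => k _; lia. Qed.

Lemma l1dist_triangle (m : nat) (x y z : 'rV[int]_m) :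
  (l1dist x z <= l1dist x y + l1dist y z)%N.
Proof. rewrite -big_split; apply: leq_sum => k _ /=. move: (x 0 k) (y 0 k) (z 0 k) => a b c; lia. Qed.

Lemma l1dist_xx (m : nat) (x : 'rV[int]_m) : l1dist x x = 0%N.
Proof. by apply: big1 => k _; rewrite subrr. Qed.

Lemma l1dist0P (m : nat) (x y : 'rV[int]_m) : l1dist x y = 0%N -> x = y.
Proof.
move/eqP; rewrite sum_nat_eq0 => /forallP h; apply/rowP => k.
by have := h k; lia.
Qed.

Lemma l1dist_add2r (m : nat) (x y z : 'rV[int]_m) :
  l1dist (x + z) (y + z) = l1dist x y.
Proof. by apply: eq_bigr => k _; rewrite !mxE; move: (x 0 k) (y 0 k) (z 0 k) => a b c; lia. Qed.

(** Stated as an equality of sums because subtraction in [nat] truncates. *)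
Lemma l1dist_step (m : nat) (x y : 'rV[int]_m) (k : 'I_m) (a : int) :
  (l1dist (x + a *: e_ k) y + `|x 0%R k - y 0%R k| =
   l1dist x y + `|(x 0%R k + a)%R - y 0%R k|)%N.
Proof.
rewrite /l1dist (bigD1 k) //= [in RHS](bigD1 k) //= !mxE !eqxx.
have -> : (\sum_(i < m | i != k) `|(x + a *: e_ k)%R 0%R i - y 0%R i| =
   \sum_(i < m | i != k) `|x 0%R i - y 0%R i|)%N.
  by apply: eq_bigr => i /negbTE ik; rewrite !mxE ik mulr0 addr0.
by rewrite mulr1; move: (\sum_(i < m | _) _)%N (x 0 k) (y 0 k) => S u v; lia.
Qed.

Lemma basis_scale1 (m : nat) (k : 'I_m) : (1 : int) *: (e_ k : 'rV[int]_m) = e_ k.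
Proof. by rewrite scale1r. Qed.

Lemma l1dist_adj (m : nat) (x : 'rV[int]_m) (k : 'I_m) : l1dist (x + e_ k) x = 1%N.
Proof.
have := l1dist_step x x k 1; rewrite basis_scale1 l1dist_xx; lia.
Qed.

(** Moving a coordinate that differs from that of [y] towards it shortens the distance by one. Both
    step cases keep edges in the form [x], [x + e_ k], in which [mhom] describes them. *)
Lemma lattice_walk_ind (m : nat) (y : 'rV[int]_m) (P : 'rV[int]_m -> Prop) :
  P y ->
  (forall (x : 'rV[int]_m) (k : 'I_m), P x -> (l1dist (x + e_ k) y = (l1dist x y).+1)%N -> P (x + e_ k)) ->
  (forall (x : 'rV[int]_m) (k : 'I_m), P (x + e_ k) -> (l1dist x y = (l1dist (x + e_ k) y).+1)%N -> P x) ->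
  forall x, P x.
Proof.
move=> Py Pup Pdown x; have [r] := ubnP (l1dist x y).
elim: r x => // r IH x lt_r.
have [eqxy | /existsNP[k neq]] := pselect (forall k, x 0 k = y 0 k).
  by have -> : x = y by apply/rowP.
have [ltk | gek] := ltP (x 0 k) (y 0 k).
  clear neq.
  have d := l1dist_step x y k 1; rewrite basis_scale1 in d.
  by apply: (Pdown x k); [apply: IH; lia | lia].
have d : (l1dist (x - e_ k)%R y + `|x 0%R k - y 0%R k| =
    l1dist x y + `|(x 0%R k - 1)%R - y 0%R k|)%N.
  by have := l1dist_step x y k (-1); rewrite scaleN1r.
have e : x = (x - e_ k) + e_ k by rewrite subrK.
have lt_d : (l1dist x y = (l1dist (x - e_ k)%R y).+1)%N.
  have ltk : y 0 k < x 0 k by rewrite lt_neqAle gek andbT; apply/eqP => /esym.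
  by clear -ltk d; lia.
have Px' : P (x - e_ k) by apply: IH; lia.
by have := Pup _ k Px'; rewrite -e; apply; lia.
Qed.

Definition coordsum (m : nat) (x : 'rV[int]_m) : int := \sum_(k < m) x 0 k.

Lemma coordsumD (m : nat) (x y : 'rV[int]_m) :
  coordsum (x + y) = coordsum x + coordsum y.
Proof. by rewrite /coordsum -big_split; apply: eq_bigr => k _; rewrite mxE. Qed.

Lemma coordsum_basis (m : nat) (k : 'I_m) : coordsum (e_ k) = 1.
Proof.
rewrite /coordsum (bigD1 k) //= basisE eqxx big1 ?addr0 // => i /negbTE ik.
by rewrite basisE ik.
Qed.

Lemma l1dist_parity (m : nat) (x y : 'rV[int]_m) :
  (2 %| (l1dist x y)%:Z - (coordsum x - coordsum y))%Z.
Proof.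
elim/(@lattice_walk_ind _ y): x => [|x k IH d|x k].
- by rewrite l1dist_xx !subrr.
- by rewrite d coordsumD coordsum_basis; lia.
by rewrite coordsumD coordsum_basis => IH d; rewrite d; lia.
Qed.

(** * The model tree *)

(* The vertex [(j, c)] of the model tree is reached from the point [j] of a
   two-sided geodesic by the word [c], read from its last letter; its Busemann
   parent [mpar] is its neighbour in the direction of the end at [-oo] of the
   geodesic. *)
Definition mvert (d : nat) : Type := (int * seq 'I_d)%type.

Definition mpar (d : nat) (v : mvert d) : mvert d :=
  if v.2 is _ :: c then (v.1, c) else (v.1 - 1, [::]).

Definition madj (d : nat) (v w : mvert d) : Prop := w = mpar v \/ v = mpar w.

Definition busemann (d : nat) (v : mvert d) : int := v.1 + (size v.2)%:Z.

Definition mshift (d : nat) (s : int) (v : mvert d) : mvert d := (v.1 + s, v.2).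

(* Two vertices are at distance at most [r] when they have common ancestors
   in generations summing to at most [r]. *)
Definition mnear (d : nat) (v w : mvert d) (r : nat) : Prop :=
  exists a b, iter a (@mpar d) v = iter b (@mpar d) w /\ (a + b <= r)%N.

Lemma madj_sym (d : nat) (v w : mvert d) : madj v w -> madj w v.
Proof. by case; [right | left]. Qed.

Lemma busemann_iter (d : nat) (a : nat) (v : mvert d) :
  busemann (iter a (@mpar d) v) = busemann v - a%:Z.
Proof.
elim: a => [|a IH]; first by rewrite subr0.
have parE (w : mvert d) : busemann (mpar w) = busemann w - 1.
  by case: w => j [|i c]; rewrite /busemann /mpar /=; lia.
by rewrite iterS parE IH; lia.
Qed.

Lemma size_iter_mpar (d : nat) (a : nat) (v : mvert d) :
  (size (iter a (@mpar d) v).2 <= size v.2)%N.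
Proof.
elim: a => //= a; case: (iter a _ v) => j [|i c] //=; lia.
Qed.

Lemma mpar_shift (d : nat) (s : int) (v : mvert d) :
  mpar (mshift s v) = mshift s (mpar v).
Proof. by case: v => j [|i c]; rewrite /mpar /mshift //=; congr pair; lia. Qed.

Lemma iter_mpar_shift (d : nat) (s : int) (a : nat) (v : mvert d) :
  iter a (@mpar d) (mshift s v) = mshift s (iter a (@mpar d) v).
Proof. by elim: a => //= a ->; rewrite mpar_shift. Qed.

Lemma busemann_shift (d : nat) (s : int) (v : mvert d) :
  busemann (mshift s v) = busemann v + s.
Proof. by rewrite /busemann /mshift /=; lia. Qed.

Lemma mshiftD (d : nat) (s t : int) (v : mvert d) :
  mshift s (mshift t v) = mshift (s + t) v.
Proof. by rewrite /mshift /=; congr pair; lia. Qed.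

Lemma mshift0 (d : nat) (v : mvert d) : mshift 0 v = v.
Proof. by case: v => j c; rewrite /mshift /= addr0. Qed.

Lemma mshift_inj (d : nat) (s : int) : injective (@mshift d s).
Proof. by move=> [j c] [j' c'] [/addIr-> ->]. Qed.

Lemma mnear_shift (d : nat) (s : int) (v w : mvert d) (r : nat) :
  mnear v w r -> mnear (mshift s v) (mshift s w) r.
Proof.
by move=> [a [b [e le]]]; exists a, b; rewrite !iter_mpar_shift e.
Qed.

Lemma mnear_sym (d : nat) (v w : mvert d) (r : nat) : mnear v w r -> mnear w v r.
Proof. by move=> [a [b [e le]]]; exists b, a; rewrite e addnC. Qed.

(** Passing to the parent of [w] saves one step of its ascent, or, when [b] is 0, moves the common
    ancestor up; passing to a child adds one step. *)
Lemma mnear_adj (d : nat) (v w w' : mvert d) (r : nat) :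
  mnear v w r -> madj w w' -> mnear v w' r.+1.
Proof.
move=> [a [b [e le]]] [-> | ew]; last first.
  by exists a, b.+1; rewrite iterSr -ew addnS.
case: b e le => [|b] e le; first by exists a.+1, 0%N; rewrite iterS e; split=> //=; lia.
by exists a, b; rewrite e iterSr; split=> //; lia.
Qed.

Lemma mnear_busemann (d : nat) (v w : mvert d) (r : nat) :
  mnear v w r -> busemann v - busemann w <= r%:Z.
Proof.
by move=> [a [b [e le]]]; have := congr1 (@busemann d) e; rewrite !busemann_iter; lia.
Qed.

(** Equality of heights makes [a] and [b] exceed the meeting generations by the same number of
    steps, and above a common ancestor the two ascents coincide. *)
Lemma mnear_iter (d : nat) (v w : mvert d) (r a b : nat) :
  mnear v w r -> busemann v - a%:Z = busemann w - b%:Z -> (r <= a + b)%N ->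
  iter a (@mpar d) v = iter b (@mpar d) w.
Proof.
move=> [a' [b' [e le]]] h hr; have := congr1 (@busemann d) e.
rewrite !busemann_iter => e'.
have [ea eb] : a = (a - a' + a')%N /\ b = (a - a' + b')%N by lia.
by rewrite ea eb !iterD e.
Qed.

Lemma mnear_fst (d : nat) (v w : mvert d) (r : nat) :
  mnear v w r -> (`|(v.1 - w.1)%R| <= r)%N.
Proof.
have it (a : nat) (u : mvert d) : (`|((iter a (@mpar d) u).1 - u.1)%R| <= a)%N.
  by elim: a => [|a] /=; [|case: (iter a _ u) => j [|i c] /=]; lia.
move=> [a [b [e le]]]; have := it a v; have := it b w; rewrite e; lia.
Qed.

Lemma iter_mpar_far (d : nat) (t : nat) (v : mvert d) :
  iter (size v.2 + t) (@mpar d) v = (v.1 - t%:Z, [::]).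
Proof.
case: v => j c /=; elim: c j => [|i c IH] j.
  rewrite add0n; elim: t => [|t IH]; first by rewrite subr0.
  by rewrite iterS IH /mpar /=; congr pair; lia.
by rewrite (_ : size (i :: c) + t = (size c + t).+1)%N // iterSr; exact: IH.
Qed.

(** Both vertices climb to the geodesic and then move along it to the smaller of their two feet. *)
Lemma mnear_far (d : nat) (v w : mvert d) (r : nat) :
  (`|(v.1 - w.1)%R| + size v.2 + size w.2 <= r)%N -> mnear v w r.
Proof.
move=> h; exists (size v.2 + `|(v.1 - Num.min v.1 w.1)%R|)%N,
  (size w.2 + `|(w.1 - Num.min v.1 w.1)%R|)%N.
rewrite !iter_mpar_far; split; last by lia.
by congr pair; lia.
Qed.

(* The last letter is the one nearest to the geodesic: after a relabelling
   depending on the point of the geodesic, the letters 0 and 1 are the colours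
   of the geodesic there. *)
Definition mvalid (d : nat) (c : seq 'I_d) : bool :=
  sorted (fun i j => i != j) c && (if c is i :: s then 1 < last i s else true)%N.

Lemma mvalid_iter (d : nat) (a : nat) (v : mvert d) :
  mvalid v.2 -> mvalid (iter a (@mpar d) v).2.
Proof.
move=> vv; elim: a => //= a; case: (iter a _ v) => j [|i [|i' c]] //=.
by rewrite /mvalid /= => /andP[/andP[_ ->] ->].
Qed.

Definition mhom (m d : nat) (H : 'rV[int]_m -> mvert d) : Prop :=
  forall x k, madj (H x) (H (x + e_ k)).

Lemma mhom_near (m d : nat) (H : 'rV[int]_m -> mvert d) (x y : 'rV[int]_m) :
  mhom H -> mnear (H x) (H y) (l1dist x y).
Proof.
move=> hH; elim/(@lattice_walk_ind _ y): x => [|x k IH ->|x k IH ->].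
- by exists 0%N, 0%N.
- by apply/mnear_sym/(mnear_adj _ (hH x k))/mnear_sym.
by apply/mnear_sym/(mnear_adj _ (madj_sym (hH x k)))/mnear_sym.
Qed.

Lemma madj_parity (d : nat) (v w : mvert d) :
  madj v w -> (2 %| busemann v - busemann w - 1)%Z.
Proof. by case=> ->; have := busemann_iter 1; move=> /= ->; lia. Qed.

Lemma mhom_parity (m d : nat) (H : 'rV[int]_m -> mvert d) (x y : 'rV[int]_m) :
  mhom H -> (2 %| busemann (H x) - busemann (H y) - (coordsum x - coordsum y))%Z.
Proof.
move=> hH; elim/(@lattice_walk_ind _ y): x => [|x k IH _|x k IH _].
- by rewrite !subrr.
- by have := madj_parity (hH x k); rewrite coordsumD coordsum_basis; lia.
by move: IH; have := madj_parity (hH x k); rewrite coordsumD coordsum_basis; lia.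
Qed.

(** * Extension of graph homomorphisms *)

(* A tree version of McShane's formula: the value at [x] is the ancestor of
   [f y] in generation [|x - y|], for a [y] in [A] where its height is largest. *)
Definition extension_at (m d : nat) (A : set 'rV[int]_m)
    (f : 'rV[int]_m -> mvert d) (x : 'rV[int]_m) (v : mvert d) : Prop :=
  exists2 y, A y & v = iter (l1dist x y) (@mpar d) (f y) /\
    forall y', A y' ->
      busemann (f y') - (l1dist x y')%:Z <= busemann (f y) - (l1dist x y)%:Z.

(** The heights to be maximised are integers bounded by [M], through comparison with [y0]; a
    maximiser is obtained by minimising the gap to [M]. *)
Lemma extension_ex (m d : nat) (A : set 'rV[int]_m)
    (f : 'rV[int]_m -> mvert d) (x y0 : 'rV[int]_m) :
  A y0 -> (forall y y', A y -> A y' -> mnear (f y) (f y') (l1dist y y')) ->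
  exists v, extension_at A f x v.
Proof.
move=> A0 hnear; pose M := busemann (f y0) + (l1dist x y0)%:Z.
pose val y := busemann (f y) - (l1dist x y)%:Z.
have val_le y : A y -> val y <= M.
  move=> Ay; have := mnear_busemann (hnear y y0 Ay A0).
  by have := l1dist_triangle y x y0; rewrite (l1dist_sym y x) /val /M; lia.
have ex : exists n, `[< exists2 y, A y & `|(M - val y)%R|%N = n >].
  by exists `|(M - val y0)%R|%N; apply/asboolP; exists y0.
case: (ex_minnP ex) => n /asboolP[y Ay ny] min_n.
exists (iter (l1dist x y) (@mpar d) (f y)), y => //; split=> // y' Ay'.
have : `[< exists2 y, A y & `|(M - val y)%R|%N = `|(M - val y')%R|%N >].
  by apply/asboolP; exists y'.
move=> /min_n; have := val_le y' Ay'; have := val_le y Ay.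
by rewrite -/(val y) -/(val y') -ny; lia.
Qed.

Lemma extension_busemann (m d : nat) (A : set 'rV[int]_m)
    (f : 'rV[int]_m -> mvert d) (x y : 'rV[int]_m) (v : mvert d) :
  extension_at A f x v -> A y -> busemann (f y) - (l1dist x y)%:Z <= busemann v.
Proof. by case=> y' Ay' [-> h] Ay; rewrite busemann_iter; exact: h. Qed.

(** Two maximisers give ancestors of equal height, and by the triangle inequality their generations
    sum to at least the distance of the base points, so [mnear_iter] applies. *)
Lemma extension_uniq (m d : nat) (A : set 'rV[int]_m)
    (f : 'rV[int]_m -> mvert d) (x : 'rV[int]_m) (v w : mvert d) :
  (forall y y', A y -> A y' -> mnear (f y) (f y') (l1dist y y')) ->
  extension_at A f x v -> extension_at A f x w -> v = w.
Proof.
move=> hnear [y Ay [-> hy]] [y' Ay' [-> hy']].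
apply: (mnear_iter (hnear y y' Ay Ay')); first by have := hy _ Ay'; have := hy' _ Ay; lia.
by have := l1dist_triangle y x y'; rewrite (l1dist_sym y x).
Qed.

Lemma extension_on (m d : nat) (A : set 'rV[int]_m)
    (f : 'rV[int]_m -> mvert d) (x : 'rV[int]_m) (v : mvert d) :
  (forall y y', A y -> A y' -> mnear (f y) (f y') (l1dist y y')) ->
  A x -> extension_at A f x v -> v = f x.
Proof.
move=> hnear Ax hv; apply: (extension_uniq hnear hv).
exists x => //; split=> [|y' Ay']; first by rewrite l1dist_xx.
by have := mnear_busemann (hnear y' x Ay' Ax); rewrite l1dist_xx (l1dist_sym y' x); lia.
Qed.

(** The two heights differ by at most one by maximality, and by an odd number by parity. A maximiser
    for the higher value is then also one for the lower value, one generation further up. *)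
Lemma extension_adj (m d : nat) (A : set 'rV[int]_m)
    (f : 'rV[int]_m -> mvert d) (x x' : 'rV[int]_m) (v v' : mvert d) :
  (forall y y', A y -> A y' -> mnear (f y) (f y') (l1dist y y')) ->
  (forall y y', A y -> A y' ->
     (2 %| busemann (f y) - busemann (f y') - (coordsum y - coordsum y'))%Z) ->
  l1dist x x' = 1%N -> extension_at A f x v -> extension_at A f x' v' -> madj v v'.
Proof.
move=> hnear hpar.
have key (z z' : 'rV[int]_m) (w w' : mvert d) : l1dist z z' = 1%N ->
    extension_at A f z w -> extension_at A f z' w' ->
    busemann w' = busemann w - 1 -> w' = mpar w.
  move=> d1 [y Ay [ew hy]] hw' hb; apply: (extension_uniq hnear hw').
  have := extension_busemann hw' Ay; rewrite hb ew busemann_iter => le1.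
  have := l1dist_triangle z' z y; rewrite (l1dist_sym z' z) d1 => le2.
  have e1 : l1dist z' y = (l1dist z y).+1 by lia.
  exists y => //; rewrite e1; split=> //.
  move=> y' Ay'; have := extension_busemann hw' Ay'; rewrite hb ew busemann_iter; lia.
move=> d1 hv hv'.
have [y Ay [ev hy]] := hv; have [y' Ay' [ev' hy']] := hv'.
have le1 := extension_busemann hv Ay'; have le2 := extension_busemann hv' Ay.
have t1 := l1dist_triangle x x' y'; have t2 := l1dist_triangle x' x y.
rewrite (l1dist_sym x' x) d1 in t2; rewrite d1 in t1.
have bv := congr1 (@busemann d) ev; have bv' := congr1 (@busemann d) ev'.
rewrite busemann_iter in bv; rewrite busemann_iter in bv'.
have p1 := hpar _ _ Ay Ay'.
have p2 := l1dist_parity x y; have p3 := l1dist_parity x' y'.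
have p4 := l1dist_parity x x'; rewrite d1 in p4.
have [e | e] : busemann v' = busemann v - 1 \/ busemann v = busemann v' - 1 by lia.
  by left; exact: key d1 hv hv' e.
by right; apply: key hv' hv e; rewrite l1dist_sym.
Qed.

Lemma extension_equivariant (m d : nat) (A : set 'rV[int]_m)
    (f : 'rV[int]_m -> mvert d) (x z : 'rV[int]_m) (s : int) (v : mvert d) :
  (forall y, A (y + z) <-> A y) ->
  (forall y, A y -> f (y + z) = mshift s (f y)) ->
  extension_at A f x v -> extension_at A f (x + z) (mshift s v).
Proof.
move=> Az fz [y Ay [-> hy]]; exists (y + z); first exact/Az.
rewrite l1dist_add2r fz // iter_mpar_shift; split=> // y' Ay'.
have Ay'' : A (y' - z) by apply/Az; rewrite subrK.
have := hy _ Ay''; rewrite -(l1dist_add2r x (y' - z) z) subrK.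
have := fz _ Ay''; rewrite subrK => ->.
by rewrite !busemann_shift; lia.
Qed.

(** * Periodic homomorphisms into the model tree *)

Definition enumerates (T : Type) (A : set T) (c : nat) (e : 'I_c -> T) : Prop :=
  injective e /\ forall t, A t <-> exists i, t = e i.

Lemma enumerates_fset_set (T : choiceType) (A : set T) :
  finite_set A -> enumerates A (tnth (in_tuple (finmap.enum_fset (fset_set A)))).
Proof.
move=> finA; split; first by apply/tuple_uniqP; exact: finmap.fset_uniq.
move=> t; have tE : (t \in finmap.enum_fset (fset_set A)) = (t \in A).
  exact: (in_fset_set finA).
split=> [At | [i ->]].
  have /(@tnthP _ _ (in_tuple _))[i ->] : t \in finmap.enum_fset (fset_set A).
    by rewrite tE inE.
  by exists i.
have := mem_tnth i (in_tuple (finmap.enum_fset (fset_set A))).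
by rewrite /= (in_fset_set finA) inE.
Qed.

Lemma enumerates_le (T : Type) (A : set T) (c c' : nat) (e : 'I_c -> T) (e' : 'I_c' -> T) :
  enumerates A e -> enumerates A e' -> (c <= c')%N.
Proof.
move=> [inj_e eA] [inj_e' e'A].
have /choice[g eg] : forall i, exists j, e i = e' j by move=> i; apply/e'A/eA; exists i.
rewrite -(card_ord c) -(card_ord c'); apply: (@leq_card _ _ g) => i j gij.
by apply: inj_e; rewrite !eg gij.
Qed.

Lemma enumerates_finite (T : Type) (A : set T) (c : nat) (e : 'I_c -> T) :
  enumerates A e -> finite_set A.
Proof.
move=> [_ eA]; have -> : A = range e.
  by apply/seteqP; split=> t; [move/eA => [i ->]; exists i | case=> i _ <-; apply/eA; exists i].
by apply: finite_image; exact: finite_finset.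
Qed.

Lemma enumerates_counting (R : realType) (T : choiceType) (A : set T) (c : nat)
    (e : 'I_c -> T) : enumerates A e -> counting A = c%:R%:E :> \bar R.
Proof.
move=> he; have finA := enumerates_finite he.
rewrite /counting asboolT //; congr (_%:R%:E).
have he' := enumerates_fset_set finA.
apply/eqP; rewrite eqn_leq; apply/andP; split.
  exact: (enumerates_le he' he).
exact: (enumerates_le he he').
Qed.

Lemma enumerates_code (T : choiceType) (E : finType) (A : set T) (code : T -> E) :
  {in A &, injective code} ->
  exists c, exists2 e : 'I_c -> T, enumerates A e & (c <= #|E|)%N.
Proof.
move=> inj_code; have finA : finite_set A.
  by rewrite -(eq_finite_set (inj_card_eq inj_code)); exact: finite_finset.
have he := enumerates_fset_set finA; do 2 eexists; first exact: he.
have [inj_e eA] := he; rewrite -[X in (X <= _)%N]card_ord.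
apply: (@leq_card _ _ (fun i => code (tnth _ i))) => i j /= /inj_code => h; apply: inj_e; apply: h.
  by rewrite inE; apply/eA; exists i.
by rewrite inE; apply/eA; exists j.
Qed.

Lemma pigeonhole_fiber (X : finType) (c : nat) (code : 'I_c -> X) : (0 < c)%N ->
  exists x, (c <= #|[set i | code i == x]%SET| * #|X|)%N.
Proof.
move=> c0; pose x0 := code (Ordinal c0).
pose F x := #|[set i | code i == x]%SET|%N.
exists [arg max_(x > x0) F x]; case: arg_maxnP => //= x _ max_x.
have {1}-> : c = (\sum_(i < c) 1)%N by rewrite sum1_card card_ord.
rewrite (partition_big code predT) //= mulnC -sum_nat_const.
apply: leq_sum => y _; rewrite sum1dep_card -/(F x).
exact: max_x.
Qed.

Definition signz (b : bool) (a : nat) : int := if b then - a%:Z else a%:Z.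

(** [eps k] is the direction of translation along the geodesic, which the slope, being a distance,
    does not see. The last two conditions render the support on the geodesic and the normalisation
    of the projection of [h 0]. *)
Definition mset (m d n : nat) (l : 'I_m -> nat) (eps : 'I_m -> bool) :
    set ('rV[int]_m -> mvert d) :=
  [set H | [/\ mhom H, forall x, mvalid (H x).2,
     forall x k, H (x + e_ k *+ n) = mshift (signz (eps k) (l k)) (H x),
     forall x, (2 * size (H x).2 <= m * n)%N &
     (H 0).1 = odd (size (H 0).2)]].

Definition mslope_set (m d n : nat) (l : 'I_m -> nat) : set ('rV[int]_m -> mvert d) :=
  [set H | exists eps : {ffun 'I_m -> bool}, mset n l eps H].

Definition zdot (m : nat) (t : 'I_m -> int) (z : 'rV[int]_m) : int :=
  \sum_(k < m) t k * z 0 k.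

Lemma zdotD (m : nat) (t : 'I_m -> int) (z w : 'rV[int]_m) :
  zdot t (z + w) = zdot t z + zdot t w.
Proof. by rewrite /zdot -big_split; apply: eq_bigr => k _; rewrite mxE mulrDr. Qed.

Lemma zdot_basis (m : nat) (t : 'I_m -> int) (k : 'I_m) : zdot t (e_ k) = t k.
Proof.
rewrite /zdot (bigD1 k) //= basisE eqxx mulr1 big1 ?addr0 // => i /negbTE ik.
by rewrite basisE ik mulr0.
Qed.

Lemma zdot0 (m : nat) (t : 'I_m -> int) : zdot t 0 = 0.
Proof. by rewrite /zdot big1 // => k _; rewrite mxE mulr0. Qed.

Lemma shift_lattice (m d n : nat) (t : 'I_m -> int) (H : 'rV[int]_m -> mvert d) :
  (forall x k, H (x + e_ k *+ n) = mshift (t k) (H x)) ->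
  forall x z, H (x + z *+ n) = mshift (zdot t z) (H x).
Proof.
move=> hH x; elim/(@lattice_walk_ind m 0) => [|z k IH _|z k IH _].
- by rewrite mul0rn addr0 zdot0 mshift0.
- by rewrite mulrnDl addrA hH IH mshiftD zdotD zdot_basis addrC.
apply: (@mshift_inj _ (t k)).
by rewrite -hH -addrA -mulrnDl IH zdotD zdot_basis mshiftD addrC.
Qed.

Definition zdivmx (m n : nat) (x : 'rV[int]_m) : 'rV[int]_m := \row_k (x ord0 k %/ n)%Z.
Definition zmodmx (m n : nat) (x : 'rV[int]_m) : 'rV[int]_m := \row_k (x ord0 k %% n)%Z.

Lemma zdivmod_eq (m n : nat) (x : 'rV[int]_m) : x = zmodmx n x + zdivmx n x *+ n.
Proof.
apply/rowP => k; rewrite mxE mulmxnE !mxE -mulr_natr natz addrC; exact: divz_eq.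
Qed.

Lemma zmodmx_bounds (m n : nat) (x : 'rV[int]_m) (k : 'I_m) : (0 < n)%N ->
  0 <= (zmodmx n x) 0 k < n%:Z.
Proof. by move=> n0; rewrite mxE modz_ge0 ?ltz_pmod //; lia. Qed.

Lemma mset_shift (m d n : nat) (l : 'I_m -> nat) (eps : 'I_m -> bool)
    (H : 'rV[int]_m -> mvert d) (x : 'rV[int]_m) :
  mset n l eps H ->
  H x = mshift (zdot (fun k => signz (eps k) (l k)) (zdivmx n x)) (H (zmodmx n x)).
Proof.
by case=> _ _ hs _ _; rewrite {1}(zdivmod_eq n x) (shift_lattice hs).
Qed.

(** Names the neighbours of [v]: [None] is the parent, [Some None] the child on the geodesic,
    [Some (Some i)] the child with new letter [i]. There are [d.+2] names. *)
Definition mcode (d : nat) (v w : mvert d) : option (option 'I_d) :=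
  if w == mpar v then None else Some (ohead w.2).

Lemma mcode_inj (d : nat) (v w w' : mvert d) :
  madj v w -> madj v w' -> mcode v w = mcode v w' -> w = w'.
Proof.
rewrite /mcode => h h'; have [-> | nw] := eqVneq w (mpar v).
  by have [-> //|] := eqVneq w' (mpar v).
have [-> // | nw'] := eqVneq w' (mpar v).
case: h nw => [->|ew _]; first by rewrite eqxx.
case: h' nw' => [->|ew' _]; first by rewrite eqxx.
move: ew; rewrite ew'; case: w w' {ew'} => j [|i c] [j' [|i' c']] //=.
  by rewrite /mpar /= => -[/addIr->].
by rewrite /mpar /= => -[-> ->] [->].
Qed.

(** On the nonnegative orthant the edges from [x] to [zprev x] form a spanning tree rooted at 0; the
    origin is its own predecessor. *)
Definition zprev (m : nat) (x : 'rV[int]_m) : 'rV[int]_m :=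
  if [pick k | x 0 k != 0] is Some k then x - e_ k else x.

(** Values are recovered one by one along the spanning tree given by [zprev]: the value at [zprev x]
    and the name of the step determine the value at [x]. *)
Lemma mhom_determined (m d : nat) (S : set 'rV[int]_m) (H H' : 'rV[int]_m -> mvert d) :
  mhom H -> mhom H' -> (forall x k, S x -> 0 <= x 0 k) ->
  (forall x, S x -> S (zprev x)) -> H 0 = H' 0 ->
  (forall x, S x -> mcode (H (zprev x)) (H x) = mcode (H' (zprev x)) (H' x)) ->
  forall x, S x -> H x = H' x.
Proof.
move=> hH hH' S0 Sprev e0 ecode x; have [r] := ubnP (l1dist x 0).
elim: r x => // r IH x lt_r Sx; have := Sprev x Sx; have := ecode x Sx.
rewrite /zprev; case: pickP => [k xk0|x0]; last first.
  by have -> // : x = 0; apply/rowP => k; rewrite mxE; apply/eqP; move/(_ k)/negbFE: x0.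
move=> ec Sx'; have xE : x = x - e_ k + e_ k by rewrite subrK.
have lt_d : (l1dist (x - e_ k) 0 < r)%N.
  have := l1dist_step (x - e_ k) 0 k 1; rewrite basis_scale1 -xE.
  have := S0 x k Sx; have := S0 _ k Sx'; rewrite !mxE !eqxx /=.
  by move: (x 0 k) xk0 => a; lia.
have e1 := IH _ lt_d Sx'.
apply: (@mcode_inj _ (H (x - e_ k))) => //; last by rewrite {2}e1.
  by have := hH (x - e_ k) k; rewrite -xE.
by rewrite e1; have := hH' (x - e_ k) k; rewrite -xE.
Qed.

Definition box_point (m n : nat) (x : {ffun 'I_m -> 'I_n}) : 'rV[int]_m :=
  \row_k (x k : nat)%:Z.

Definition face_point (m n : nat) (k : 'I_m) (y : {ffun 'I_m.-1 -> 'I_n}) : 'rV[int]_m :=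
  \row_i (if unlift k i is Some i' then (y i' : nat)%:Z else 0).

Lemma box_pointP (m n : nat) (x : 'rV[int]_m) :
  (forall k, 0 <= x 0 k < n%:Z) -> exists y : {ffun 'I_m -> 'I_n}, x = box_point y.
Proof.
move=> hx; have /choice[y hy] : forall k, exists i : 'I_n, x 0 k = (i : nat)%:Z.
  move=> k; have /andP[x0 xn] := hx k.
  have lt_n : (`|x 0%R k| < n)%N by lia.
  by exists (Ordinal lt_n) => /=; lia.
by exists [ffun k => y k]; apply/rowP => k; rewrite mxE ffunE hy.
Qed.

Lemma face_pointP (m n : nat) (x : 'rV[int]_m) (k : 'I_m) :
  (forall i, 0 <= x 0 i < n%:Z) -> x 0 k = 0 ->
  exists y : {ffun 'I_m.-1 -> 'I_n}, x = face_point k y.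
Proof.
move=> /box_pointP[y ey] xk; exists [ffun i => y (lift k i)].
apply/rowP => i; rewrite mxE; case: unliftP => [j ->|->]; last exact: xk.
by rewrite ffunE ey mxE.
Qed.

(** * Gluing *)

(** It records [m * n ^ m.-1] steps, against [n ^ m] for [box_code], so fixing it is a surface
    cost. *)
Definition face_code (m d n : nat) (H : 'rV[int]_m -> mvert d) :
    {ffun 'I_m -> {ffun {ffun 'I_m.-1 -> 'I_n} -> option (option 'I_d)}} :=
  [ffun k => [ffun y => mcode (H (zprev (face_point k y))) (H (face_point k y))]].

Definition box_code (m d n : nat) (H : 'rV[int]_m -> mvert d) :
    {ffun {ffun 'I_m -> 'I_n} -> option (option 'I_d)} :=
  [ffun y => mcode (H (zprev (box_point y))) (H (box_point y))].

Definition word_code (d L : nat) (c : seq 'I_d) : {ffun 'I_L -> option 'I_d} :=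
  [ffun i : 'I_L => nth None (map some c) i].

Lemma word_code_inj (d L : nat) (c c' : seq 'I_d) :
  (size c <= L)%N -> (size c' <= L)%N -> word_code L c = word_code L c' -> c = c'.
Proof.
move=> sc sc' /ffunP ecode.
have {ecode} : forall i, nth None (map some c) i = nth None (map some c') i.
  move=> i; have [lt_iL | le_Li] := ltnP i L.
    by have := ecode (Ordinal lt_iL); rewrite !ffunE.
  by rewrite !nth_default // size_map; lia.
elim: c c' {sc sc'} => [|i c IH] [|i' c'] // e; try by have := e 0%N.
have := e 0%N; rewrite /= => -[->]; congr cons.
by apply: IH => j; exact: (e j.+1).
Qed.

Lemma mset_origin (m d n : nat) (l : 'I_m -> nat) (eps : 'I_m -> bool)
    (H H' : 'rV[int]_m -> mvert d) :
  mset n l eps H -> mset n l eps H' -> (H 0).2 = (H' 0).2 -> H 0 = H' 0.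
Proof.
move=> [_ _ _ _ e1] [_ _ _ _ e1'] e2.
by rewrite [LHS]surjective_pairing [RHS]surjective_pairing e1 e1' e2.
Qed.

Lemma zprev_bounds (m : nat) (x : 'rV[int]_m) (n : int) :
  (forall k, 0 <= x 0 k < n) -> forall k, 0 <= zprev x 0 k < n.
Proof.
move=> hx i; rewrite /zprev; case: pickP => // k; have := hx i; rewrite !mxE eqxx /=.
have [-> | _] := eqVneq i k; last by rewrite subr0.
by move: (x 0 k) => a; lia.
Qed.

Lemma zprev_zero (m : nat) (x : 'rV[int]_m) (k : 'I_m) :
  x 0 k = 0 -> zprev x 0 k = 0.
Proof.
move=> xk; rewrite /zprev; case: pickP => // i; rewrite !mxE xk eqxx /=.
by have [<- | _] := eqVneq k i; rewrite ?xk ?eqxx ?subr0.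
Qed.

(** A point with a coordinate divisible by [n] is a translate of a point on a face of the box, and
    the union of these faces is closed under [zprev]. *)
Lemma mset_face_agree (m d n : nat) (l : 'I_m -> nat) (eps : 'I_m -> bool)
    (H H' : 'rV[int]_m -> mvert d) (x : 'rV[int]_m) (k : 'I_m) : (0 < n)%N ->
  mset n l eps H -> mset n l eps H' -> (H 0).2 = (H' 0).2 ->
  face_code n H = face_code n H' -> (n %| x 0%R k)%Z -> H x = H' x.
Proof.
move=> n0 hH hH' e0 ecode nxk; rewrite (mset_shift x hH) (mset_shift x hH').
congr mshift; have [hom _ _ _ _] := hH; have [hom' _ _ _ _] := hH'.
pose S : set 'rV[int]_m :=
  [set y | (forall i, 0 <= y 0 i < n%:Z) /\ exists i, y 0 i = 0].
apply: (@mhom_determined _ _ S) => //.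
- by move=> y i [hy _]; have /andP[] := hy i.
- move=> y [hy [i yi]]; split; first exact: zprev_bounds.
  by exists i; exact: zprev_zero.
- exact: mset_origin hH hH' e0.
- move=> y [hy [i yi]]; have [z ->] := face_pointP hy yi.
  by move/ffunP/(_ i): ecode; rewrite !ffunE => /ffunP/(_ z); rewrite !ffunE.
split=> [i|]; first exact: zmodmx_bounds.
by exists k; rewrite mxE; apply/dvdz_mod0P.
Qed.

Lemma mset_box_eq (m d n : nat) (l : 'I_m -> nat) (eps : 'I_m -> bool)
    (H H' : 'rV[int]_m -> mvert d) : (0 < n)%N ->
  mset n l eps H -> mset n l eps H' ->
  (forall x : 'rV[int]_m, (forall k, 0 <= x 0 k < n%:Z) -> H x = H' x) -> H = H'.
Proof.
move=> n0 hH hH' e; apply/funext => x.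
by rewrite (mset_shift x hH) (mset_shift x hH') e // => k; exact: zmodmx_bounds.
Qed.

Lemma mset_box_code (m d n : nat) (l : 'I_m -> nat) (eps : 'I_m -> bool)
    (H H' : 'rV[int]_m -> mvert d) : (0 < n)%N ->
  mset n l eps H -> mset n l eps H' -> (H 0).2 = (H' 0).2 ->
  box_code n H = box_code n H' -> H = H'.
Proof.
move=> n0 hH hH' e0 ecode; apply: (mset_box_eq n0 hH hH') => x hx.
have [hom _ _ _ _] := hH; have [hom' _ _ _ _] := hH'.
apply: (@mhom_determined _ _ [set y : 'rV[int]_m | forall i, 0 <= y 0 i < n%:Z]) => //.
- by move=> y i hy; have /andP[] := hy i.
- by move=> y hy; exact: zprev_bounds.
- exact: mset_origin hH hH' e0.
by move=> y /box_pointP[z ->]; move/ffunP/(_ z): ecode; rewrite !ffunE.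
Qed.

(** The signs are not unique where [l k] is 0, hence a choice. *)
Definition eps_of (m d n : nat) (l : 'I_m -> nat) (H : 'rV[int]_m -> mvert d) :
    {ffun 'I_m -> bool} :=
  xget [ffun=> false] [set eps : {ffun 'I_m -> bool} | mset n l eps H].

Lemma eps_ofP (m d n : nat) (l : 'I_m -> nat) (H : 'rV[int]_m -> mvert d) :
  mslope_set n l H -> mset n l (eps_of n l H) H.
Proof. 
move=> [eps hH].
exact: (@xgetPex _ [ffun=> false] [set e : {ffun 'I_m -> bool} | mset n l e H]
  (ex_intro _ eps hH)).
 Qed.

Lemma mset_size (m d n : nat) (l : 'I_m -> nat) (eps : 'I_m -> bool)
    (H : 'rV[int]_m -> mvert d) x : mset n l eps H -> (size (H x).2 <= m * n)%N.
Proof. by case=> _ _ _ /(_ x) h _; apply: leq_trans h; rewrite leq_pmull. Qed.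

Lemma mslope_set_enum (m d n : nat) (l : 'I_m -> nat) : (0 < n)%N ->
  exists c, exists2 e : 'I_c -> ('rV[int]_m -> mvert d),
    enumerates (mslope_set n l) e &
    (c <= 2 ^ m * d.+1 ^ (m * n) * d.+2 ^ (n ^ m))%N.
Proof.
move=> n0.
pose code (H : 'rV[int]_m -> mvert d) :=
  ((eps_of n l H, word_code (m * n) (H 0).2), box_code n H).
have inj_code : {in mslope_set n l &, injective code}.
  move=> H H'; rewrite !inE => /eps_ofP hH /eps_ofP hH' [ee ew eb].
  rewrite -ee in hH'; apply: (mset_box_code n0 hH hH' _ eb).
  by apply: word_code_inj ew; [exact: mset_size hH | exact: mset_size hH'].
have [c [e he le_c]] := enumerates_code inj_code; exists c, e => //.
apply: leq_trans le_c _.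
by rewrite !card_prod !card_ffun !card_option !card_ord card_bool.
Qed.

Lemma divz_succ (a : int) (n : nat) : (0 < n)%N -> ~~ (n %| a + 1)%Z ->
  ((a + 1) %/ n)%Z = (a %/ n)%Z.
Proof.
move=> n0 ndvd; have eq_a := divz_eq a n.
have ge0 := modz_ge0 a (_ : n%:Z != 0); have lt := ltz_pmod a (_ : 0 < n%:Z).
have {}ge0 : 0 <= (a %% n)%Z by apply: ge0; lia.
have {}lt : (a %% n)%Z < n%:Z by apply: lt; lia.
have [e | ne] := eqVneq ((a %% n)%Z + 1) n%:Z.
  suff : (n %| a + 1)%Z by rewrite (negbTE ndvd).
  have -> : a + 1 = ((a %/ n)%Z + 1) * n by rewrite {1}eq_a -addrA e mulrDl mul1r.
  exact: dvdz_mull.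
have -> : a + 1 = (a %/ n)%Z * n + ((a %% n)%Z + 1) by rewrite addrA -eq_a.
rewrite divzMDl; last by lia.
have small : 0 <= (a %% n)%Z + 1 < `|n%:Z| by lia.
by rewrite (divz_small small) addr0.
Qed.

(** An edge either stays in one cell or ends on a hyperplane of the grid, where all fillings
    agree. *)
Lemma mhom_glue (m d n : nat) (I : Type) (Hs : I -> 'rV[int]_m -> mvert d)
    (w : 'rV[int]_m -> I) : (0 < n)%N -> (forall i, mhom (Hs i)) ->
  (forall i j (x : 'rV[int]_m) k, (n %| x 0%R k)%Z -> Hs i x = Hs j x) ->
  mhom (fun x => Hs (w (zdivmx n x)) x).
Proof.
move=> n0 hom agree x k.
have [nxk | nxk] := boolP (n %| (x + e_ k) 0%R k)%Z.
  by rewrite (agree _ (w (zdivmx n x)) _ _ nxk); exact: hom.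
have -> : zdivmx n (x + e_ k) = zdivmx n x; last exact: hom.
apply/rowP => i; rewrite !mxE eqxx /=; have [ik | _] := eqVneq i k; last by rewrite addr0.
move: nxk; rewrite -ik !mxE !eqxx; exact: divz_succ.
Qed.

(** * Periodic extension from a box *)

Lemma zmodmx_shift (m N : nat) (y : 'rV[int]_m) (z : 'rV[int]_m) :
  zmodmx N (y + z *+ N) = zmodmx N y.
Proof.
apply/rowP => k; rewrite !mxE mulmxnE -mulr_natr natz addrC; exact: modzMDl.
Qed.

Lemma zdivmx_shift (m N : nat) (y : 'rV[int]_m) (z : 'rV[int]_m) : (0 < N)%N ->
  zdivmx N (y + z *+ N) = zdivmx N y + z.
Proof.
move=> N0; apply/rowP => k; rewrite !mxE mulmxnE -mulr_natr natz addrC divzMDl; last lia.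
by rewrite addrC.
Qed.

Lemma coordsumMn (m N : nat) (z : 'rV[int]_m) : coordsum (z *+ N) = coordsum z *+ N.
Proof. by rewrite /coordsum -sumrMnl; apply: eq_bigr => k _; rewrite mulmxnE. Qed.

Lemma zmodmx_small (m N : nat) (y : 'rV[int]_m) :
  (forall k, 0 <= y 0 k < N%:Z) -> zmodmx N y = y /\ zdivmx N y = 0.
Proof.
move=> hy; split; apply/rowP => k; have /andP[y0 yN] := hy k; rewrite !mxE.
  by rewrite modz_small // y0 /=; lia.
by rewrite divz_small // y0 /=; lia.
Qed.

Lemma zdot_parity (m N : nat) (t : 'I_m -> int) (z : 'rV[int]_m) :
  (forall k, (2 %| t k - N%:Z)%Z) -> (2 %| zdot t z - coordsum z *+ N)%Z.
Proof.
move=> ht; rewrite /zdot /coordsum -sumrMnl -sumrB.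
apply: rpred_sum => k _; have -> : t k * z 0 k - z 0 k *+ N = (t k - N%:Z) * z 0 k.
  by rewrite mulrBl -[_ *+ N]mulr_natl natz.
exact: dvdz_mulr.
Qed.

Lemma signz_parity (b : bool) (a N : nat) :
  odd a = odd N -> (2 %| signz b a - N%:Z)%Z.
Proof. by case: b => /=; lia. Qed.

Lemma absz_sum_le (m : nat) (F : 'I_m -> int) :
  (`|(\sum_(k < m) F k)%R| <= \sum_(k < m) `|F k|)%N.
Proof.
elim/big_ind2: _ => // x1 x2 y1 y2 h1 h2.
by lia.
Qed.

Lemma absz_perturb (A B r : int) (q n : nat) :
  (`|A| + q <= `|B|)%N -> (`|r| < n)%N -> (`|A| + q <= `|(B + r)%R| + n)%N.
Proof. by lia. Qed.

(** [Z] is a difference of cell indices in a box, [E] a difference of [N]-translates. The reserve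
    [4 * m * n] pays [m * n] for rounding to cells, [2 * m * n] for two height estimates and [m * n]
    for two depths. *)
Definition separated (m n N K : nat) (l l' : 'I_m -> nat) : Prop :=
  forall k (Z E : int), E != 0 -> (`|Z| < K)%N ->
    (`|((l k)%:Z * Z + (l' k)%:Z * E)%R| + 4 * m * n <=
     `|(n%:Z * Z + N%:Z * E)%R|)%N.

(* Between distinct [N]-translates of the box [0, Kn)^m the separation
   hypothesis pays for the depths and for the error in the height estimate. *)
Lemma separation_sum (m n N K : nat) (l l' : 'I_m -> nat) (eps : 'I_m -> bool)
    (x x' e e' : 'rV[int]_m) : (0 < n)%N -> (K * n <= N)%N ->
  (forall k, l k <= n)%N ->
  separated n N K l l' ->
  (forall k, 0 <= x 0 k < (K * n)%:Z) -> (forall k, 0 <= x' 0 k < (K * n)%:Z) ->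
  e != e' ->
  (`|((zdot (fun k => signz (eps k) (l k)) (zdivmx n x) +
      zdot (fun k => signz (eps k) (l' k)) e) -
     (zdot (fun k => signz (eps k) (l k)) (zdivmx n x') +
      zdot (fun k => signz (eps k) (l' k)) e'))%R| + 3 * m * n <=
    l1dist (x + e *+ N)%R (x' + e' *+ N)%R)%N.
Proof.
move=> n0 leKN le_l sep hx hx' nee.
pose Z k := (zdivmx n x - zdivmx n x') 0 k; pose E k := (e - e') 0 k.
pose a k := `|((l k)%:Z * Z k + (l' k)%:Z * E k)%R|%N.
pose b k := `|((x + e *+ N) 0 k - (x' + e' *+ N) 0 k)%R|%N.
have Zlt k : (`|Z k| < K)%N.
  have bnd (y : 'rV[int]_m) : (forall k, 0 <= y 0 k < (K * n)%:Z) ->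
      0 <= zdivmx n y 0 k < K%:Z.
    move=> hy; have /andP[y0 yK] := hy k; rewrite mxE divz_ge0; last by lia.
    by rewrite y0 ltz_divLR; [rewrite -PoszM | lia].
  have := bnd _ hx; have := bnd _ hx'; rewrite /Z !mxE; clear.
  by move: (divz _ _) (divz _ _) => u v; lia.
have bE k : exists r : int, (`|r| < n)%N /\
    (x + e *+ N) 0 k - (x' + e' *+ N) 0 k = n%:Z * Z k + N%:Z * E k + r.
  exists ((x 0%R k %% n)%Z - (x' 0%R k %% n)%Z); split.
    have := zmodmx_bounds x k n0; have := zmodmx_bounds x' k n0; rewrite !mxE.
    by clear; move: (modz _ _) (modz _ _) => u v; lia.
  have := divz_eq (x 0 k) n; have := divz_eq (x' 0 k) n.
  have mulzn (z : int) : z *+ N = z * N%:Z by rewrite -mulr_natr natz.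
  rewrite /Z /E !mxE !mulmxnE !mulzn; clear.
  move: (modz _ _) (modz _ _) (divz _ _) (divz _ _) => u v p q.
  by move: (x 0 k) (x' 0 k) (e 0 k) (e' 0 k) => a b f g -> ->; ring.
(* Coordinates in which the translates agree need only [l k <= n]. *)
have ab k : (a k <= b k + n)%N.
  have [r [r1 r2]] := bE k; rewrite /b r2 -[a k]addn0; apply: absz_perturb r1.
  have [E0 | En0] := eqVneq (E k) 0; last first.
    by rewrite addn0; apply: leq_trans (leq_addr _ _) (sep k _ _ En0 (Zlt k)).
  by rewrite addn0 E0 !mulr0 !addr0 !abszM leq_mul2r le_l orbT.
have [k0 Ek0] : exists k0, E k0 != 0.
  apply/existsP; apply: contraNT nee; rewrite negb_exists => /forallP h.
  rewrite -subr_eq0; apply/eqP/rowP => k; rewrite [RHS]mxE.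
  by apply/eqP; have := h k; rewrite negbK.
(* One coordinate in which the translates differ provides the whole reserve. *)
have ab0 : (a k0 + 4 * m * n <= b k0 + n)%N.
  have [r [r1 r2]] := bE k0; rewrite /b r2; apply: absz_perturb r1.
  exact: sep Ek0 (Zlt k0).
have sum_ab : (\sum_(k < m) a k + 4 * m * n <= \sum_(k < m) b k + m * n)%N.
  rewrite (bigD1 k0) //= [X in (_ <= X + _)%N](bigD1 k0) //=.
  have : (\sum_(i < m | i != k0) a i <= \sum_(i < m | i != k0) (b i + n))%N.
    by apply: leq_sum => k _; exact: ab.
  rewrite big_split /=; have : (\sum_(i < m | i != k0) n + n = m * n)%N.
    by rewrite -[in RHS](card_ord m) -sum_nat_const [in RHS](bigD1 k0) //= addnC.
  move: ab0; clear; move: (a k0) (b k0) => u v.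
  move: (\sum_(_ < m | _) _)%N (\sum_(_ < m | _) _)%N (\sum_(_ < m | _) _)%N.
  by move=> s1 s2 s3; move: (m * n)%N (4 * m * n)%N => q p; lia.
have le_a : (`|((zdot (fun k => signz (eps k) (l k)) (zdivmx n x) +
      zdot (fun k => signz (eps k) (l' k)) e) -
     (zdot (fun k => signz (eps k) (l k)) (zdivmx n x') +
      zdot (fun k => signz (eps k) (l' k)) e'))%R| <= \sum_(k < m) a k)%N.
  rewrite /zdot -!big_split -sumrB /=.
  apply: leq_trans (absz_sum_le _) _; apply: leq_sum => k _.
  rewrite /a /Z /E !mxE /signz; clear.
  set A := (X in (absz X <= _)%N); set B := (X in (_ <= absz X)%N).
  suff [->|->] : A = B \/ A = - B by lia.
  by rewrite /A /B; case: (eps k); [right | left]; ring.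
have bE' : l1dist (x + e *+ N) (x' + e' *+ N) = (\sum_(k < m) b k)%N by [].
rewrite bE'; move: sum_ab le_a; clear; move: (absz _) (\sum_(_ < m) _)%N (\sum_(_ < m) _)%N.
by move=> u s1 s2; rewrite -!mulnA; move: (m * n)%N => q; lia.
Qed.

Lemma l1dist_cell (m n : nat) (x : 'rV[int]_m) : (0 < n)%N ->
  (l1dist x (zdivmx n x *+ n) <= m * n)%N.
Proof.
move=> n0; rewrite -[X in (_ <= X * _)%N](card_ord m) -sum_nat_const.
apply: leq_sum => k _; rewrite {1}(zdivmod_eq n x) mxE addrK.
by have := zmodmx_bounds x k n0; move: (zmodmx _ _ _ _) => u; clear; lia.
Qed.

Lemma cell_height (m d n : nat) (t : 'I_m -> int) (f : 'rV[int]_m -> mvert d)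
    (x : 'rV[int]_m) : (0 < n)%N -> mhom f ->
  (forall z, f (z *+ n) = mshift (zdot t z) (f 0)) ->
  (`|((f x).1 - ((f 0).1 + zdot t (zdivmx n x)))%R| <= m * n)%N.
Proof.
move=> n0 homf ft; have := mnear_fst (mhom_near x (zdivmx n x *+ n) homf).
by rewrite ft; move=> h; apply: leq_trans (l1dist_cell x n0).
Qed.

Section PeriodicExtension.
Variables (m d n N K : nat) (l l' : 'I_m -> nat) (eps : 'I_m -> bool).
Variable f : 'rV[int]_m -> mvert d.
Hypotheses (n0 : (0 < n)%N) (K0 : (0 < K)%N) (leKN : (K * n <= N)%N).
Hypotheses (le_l : forall k, (l k <= n)%N) (sep : separated n N K l l').
Hypothesis par : forall k, odd (l' k) = odd N.
Hypotheses (homf : mhom f) (validf : forall x, mvalid (f x).2).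
Hypothesis depthf : forall x, (2 * size (f x).2 <= m * n)%N.
Hypothesis originf : (f 0).1 = odd (size (f 0).2).
Hypothesis shiftf :
  forall z, f (z *+ n) = mshift (zdot (fun k => signz (eps k) (l k)) z) (f 0).

Let N0 : (0 < N)%N. Proof. by nia. Qed.
Let t' k := signz (eps k) (l' k).
(** The union of the [N]-translates of the box of side [K * n]; [g] continues [f] to it with the
    translations prescribed by [l']. *)
Let A : set 'rV[int]_m := [set y | forall k, zmodmx N y 0 k < (K * n)%:Z].
Let g y := mshift (zdot t' (zdivmx N y)) (f (zmodmx N y)).

Let A_box y : A y -> forall k, 0 <= zmodmx N y 0 k < (K * n)%:Z.
Proof. by move=> Ay k; rewrite (Ay k) andbT; have /andP[] := zmodmx_bounds y k N0. Qed.

(** Within one translate this is the distance bound for [f]; points of distinct translates are so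
    far apart that the route through the geodesic is short enough. *)
Let g_near y y' : A y -> A y' -> mnear (g y) (g y') (l1dist y y').
Proof.
move=> /A_box Ay /A_box Ay'.
have eqy := zdivmod_eq N y; have eqy' := zdivmod_eq N y'.
have [e | ne] := eqVneq (zdivmx N y) (zdivmx N y').
  rewrite /g e; apply: mnear_shift; rewrite eqy eqy' e l1dist_add2r.
  by rewrite -e -eqy e -eqy'; exact: mhom_near.
have := separation_sum eps n0 leKN le_l sep Ay Ay' ne; rewrite -eqy -eqy' => h.
apply: mnear_far; rewrite /g /=.
have := cell_height (zmodmx N y) n0 homf shiftf.
have := cell_height (zmodmx N y') n0 homf shiftf.
have := depthf (zmodmx N y); have := depthf (zmodmx N y').
move: h; rewrite -/t' -!mulnA; clear; move: (m * n)%N => q.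
move: (zdot t' (zdivmx N y)) (zdot t' (zdivmx N y')) => z1 z2.
move: (zdot _ (zdivmx n _)) (zdot _ (zdivmx n (zmodmx N y'))) => z3 z4.
move: (f 0).1 (f (zmodmx N y)) (f (zmodmx N y')) (l1dist y y').
move=> f0 [f1 s1] [f2 s2] L /=; move: (size s1) (size s2) => r1 r2; lia.
Qed.

Let g_parity y y' : A y -> A y' ->
  (2 %| busemann (g y) - busemann (g y') - (coordsum y - coordsum y'))%Z.
Proof.
move=> _ _; rewrite /g !busemann_shift.
rewrite {3}(zdivmod_eq N y) {3}(zdivmod_eq N y') !coordsumD !coordsumMn.
have := mhom_parity (zmodmx N y) (zmodmx N y') homf.
have p k : (2 %| t' k - N%:Z)%Z by apply: signz_parity.
have := zdot_parity (zdivmx N y) p; have := zdot_parity (zdivmx N y') p.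
clear; move: (zdot _ _) (zdot _ _) (_ *+ N) (_ *+ N) => a b a' b'.
by move: (busemann _) (busemann _) (coordsum _) (coordsum _) => u u' v v'; lia.
Qed.

(** [F] is the McShane extension of [g]. Ancestors are no deeper than the values of [g], which
    preserves the depth bound, and uniqueness of the extension gives the translation rule. *)
Lemma mset_extend : exists F, mset N l' eps F /\
  forall x : 'rV[int]_m, (forall k, 0 <= x 0 k < (K * n)%:Z) -> F x = f x.
Proof.
have box_g (x : 'rV[int]_m) : (forall k, 0 <= x 0 k < (K * n)%:Z) -> A x /\ g x = f x.
  move=> hx; have hxN k : 0 <= x 0 k < N%:Z.
    by have := hx k; move: leKN (x 0 k); clear; move=> h u; lia.
  have [em ed] := zmodmx_small hxN; rewrite /A /g /= em ed zdot0 mshift0.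
  by split=> // k; have /andP[] := hx k.
have A0 : A 0 /\ g 0 = f 0.
  by apply: box_g => k; rewrite mxE lexx /= ltz_nat muln_gt0 K0.
have /choice[F hF] : forall x, exists v, extension_at A g x v.
  by move=> x; exact: extension_ex A0.1 g_near.
have Fg x : A x -> F x = g x by move=> Ax; exact: extension_on g_near Ax (hF x).
exists F; split; last by move=> x /box_g[Ax <-]; exact: Fg.
have gsize x : (2 * size (g x).2 <= m * N)%N.
  apply: leq_trans (depthf _) _; rewrite leq_mul2l; apply/orP; right.
  by apply: leq_trans leKN; exact: leq_pmull.
split.
- move=> x k; apply: (extension_adj g_near g_parity _ (hF x) (hF _)).
  by rewrite l1dist_sym l1dist_adj.
- by move=> x; have [y _ [-> _]] := hF x; apply: mvalid_iter; exact: validf.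
- move=> x k; apply: (extension_uniq g_near (hF _)).
  apply: extension_equivariant (hF x) => y.
    by rewrite /A /= zmodmx_shift.
  by move=> _; rewrite /g zmodmx_shift zdivmx_shift // zdotD zdot_basis mshiftD addrC.
- move=> x; have [y _ [-> _]] := hF x; apply: leq_trans (gsize y).
  by rewrite leq_mul2l size_iter_mpar.
by rewrite (Fg _ A0.1) A0.2.
Qed.

End PeriodicExtension.

(** The number of codes available to the pigeonhole principle: signs, word at the origin, steps on
    the [m] faces. *)
Definition glue_cost (m d n : nat) : nat :=
  (2 ^ m * d.+1 ^ (m * n) * (d.+2 ^ (n ^ m.-1)) ^ m)%N.

(* Cells with the same values on the grid of faces can be filled independently. *)
Lemma mslope_gluing (m d n N K : nat) (l l' : 'I_m -> nat) (c c' : nat)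
    (e : 'I_c -> 'rV[int]_m -> mvert d) (e' : 'I_c' -> 'rV[int]_m -> mvert d) :
  (0 < m)%N -> (0 < n)%N -> (0 < K)%N -> (K * n <= N)%N ->
  (forall k, (l k <= n)%N) -> separated n N K l l' -> (forall k, odd (l' k) = odd N) -> (0 < c)%N ->
  enumerates (mslope_set n l) e -> enumerates (mslope_set N l') e' ->
  exists F : nat, (c <= F * glue_cost m d n)%N /\ (F ^ (K ^ m) <= c')%N.
Proof.
move=> m_gt0 n0 K0 leKN le_l sep par c0 [inj_e eP] [inj_e' e'P].
have he i : mset n l (eps_of n l (e i)) (e i) by apply/eps_ofP/eP; exists i.
(* Equal codes mean equal directions, equal values at the origin and equal values on the whole
   grid. *)
pose code i :=
  ((eps_of n l (e i), word_code (m * n) (e i 0).2), face_code n (e i)).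
have [x le_c] := pigeonhole_fiber code c0.
set F := [set i | code i == x]%SET in le_c.
exists #|F|; split.
  apply: leq_trans le_c _; rewrite leq_mul2l; apply/orP; right.
  by rewrite !card_prod !card_ffun !card_option !card_ord card_bool.
have [i0 Fi0] : exists i, i \in F.
  by apply/set0Pn; rewrite -card_gt0; case: #|F| le_c => //; rewrite mul0n; lia.
pose eps := eps_of n l (e i0).
have codeF i : i \in F -> code i = code i0.
  by move: Fi0; rewrite !inE => /eqP -> /eqP ->.
have epsF i : i \in F -> mset n l eps (e i).
  by move=> /codeF[ee _ _]; have := he i; rewrite ee.
have zeroF i j : i \in F -> j \in F -> (e i 0).2 = (e j 0).2.
  move=> Fi Fj; apply: (@word_code_inj _ (m * n)).
  - exact: mset_size (epsF i Fi).
  - exact: mset_size (epsF j Fj).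
  by have [_ -> _] := codeF i Fi; have [_ -> _] := codeF j Fj.
have gridF i j (y : 'rV[int]_m) k : i \in F -> j \in F -> (n %| y 0%R k)%Z ->
    e i y = e j y.
  move=> Fi Fj; apply: (mset_face_agree n0 (epsF i Fi) (epsF j Fj)).
    exact: zeroF.
  by have [_ _ ->] := codeF i Fi; have [_ _ ->] := codeF j Fj.
(* Reduction modulo [K] makes the cell index total; inside the box it changes nothing. *)
pose cell (z : 'rV[int]_m) : {ffun 'I_m -> 'I_K} :=
  [ffun k => Ordinal (ltn_pmod `|z 0%R k| K0)].
pose G (w : {ffun {ffun 'I_m -> 'I_K} -> {i | i \in F}}) (y : 'rV[int]_m) :=
  e (val (w (cell (zdivmx n y)))) y.
have extG w : exists H, mset N l' eps H /\
    forall y : 'rV[int]_m, (forall k, 0 <= y 0 k < (K * n)%:Z) -> H y = G w y.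
  have mG y : exists2 i, i \in F & G w y = e i y.
    by exists (val (w (cell (zdivmx n y)))) => //; exact: valP.
  have grid0 z : G w (z *+ n) = e i0 (z *+ n).
    have [i Fi ->] := mG (z *+ n).
    apply: (gridF _ _ _ (Ordinal m_gt0)) => //.
    by rewrite mulmxnE -mulr_natr natz dvdz_mull.
  have G0 : G w 0 = e i0 0 by have := grid0 0; rewrite mul0rn.
  have [hom0 val0 shift0 depth0 origin0] := epsF i0 Fi0.
  apply: (@mset_extend m d n N K l l' eps (G w)) => //.
  - apply: (@mhom_glue _ _ _ _ (fun i : {i | i \in F} => e (val i))
      (fun z => w (cell z))) => //.
      by move=> i; have [] := epsF _ (valP i).
    by move=> i j y k; apply: gridF; exact: valP.
  - by move=> y; have [i Fi ->] := mG y; have [] := epsF _ Fi.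
  - by move=> y; have [i Fi ->] := mG y; have [] := epsF _ Fi.
  - by rewrite G0.
  by move=> z; rewrite grid0 G0 -[z *+ n]add0r (shift_lattice shift0).
have /choice[H hH] := extG.
have /choice[j hj] : forall w, exists j, H w = e' j.
  by move=> w; apply/e'P; exists eps; exact: (hH w).1.
rewrite -[X in (_ <= X)%N]card_ord -[X in (X ^ _)%N]card_sig.
have -> : (K ^ m)%N = #|{ffun 'I_m -> 'I_K}| by rewrite card_ffun !card_ord.
rewrite -card_ffun; apply: (@leq_card _ _ j) => w w' jw.
have eqH : H w = H w' by rewrite !hj jw.
apply/ffunP => z; apply/val_inj/inj_e.
have hz := epsF _ (valP (w z)); have hz' := epsF _ (valP (w' z)).
apply: (mset_box_eq n0 hz hz') => y hy.
(* The filling used in cell [z] is read off after moving the base cell there. *)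
pose Z : 'rV[int]_m := \row_k (z k : nat)%:Z.
suff : e (val (w z)) (y + Z *+ n) = e (val (w' z)) (y + Z *+ n).
  have [_ _ s _ _] := hz; have [_ _ s' _ _] := hz'.
  by rewrite (shift_lattice s) (shift_lattice s') => /mshift_inj.
have [my dy] := zmodmx_small hy.
have cellZ : cell (zdivmx n (y + Z *+ n)) = z.
  rewrite zdivmx_shift // dy add0r; apply/ffunP => k; apply: val_inj.
  by rewrite ffunE /= mxE modn_small // ltn_ord.
have box k : 0 <= (y + Z *+ n) 0 k < (K * n)%:Z.
  rewrite !mxE mulmxnE mxE -mulr_natr natz; have := hy k; have := ltn_ord (z k).
  by move: (y 0 k) (z k : nat) => u v; clear; nia.
have := (hH w).2 _ box; have := (hH w').2 _ box; rewrite /G cellZ => <- <-.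
by rewrite eqH.
Qed.

Lemma mset_parity (m d n : nat) (l : 'I_m -> nat) (eps : 'I_m -> bool)
    (H : 'rV[int]_m -> mvert d) (k : 'I_m) : mset n l eps H -> odd (l k) = odd n.
Proof.
case=> homH _ shiftH _ _; have := mhom_parity (0 + e_ k *+ n) 0 homH.
rewrite shiftH busemann_shift coordsumD coordsumMn coordsum_basis.
by case: (eps k) => /=; move: (busemann _) (coordsum _) => u v; lia.
Qed.

(** * Convergence of the entropy of the model *)

(** The limit is the supremum of the eventual lower bounds of [a] along [P]; almost monotonicity
    makes [a n - eta / 2] such a lower bound for late [n]. *)
Lemma almost_monotone_limit (R : realType) (P : nat -> Prop) (a : nat -> R) (C : R) :
  (forall n, (0 < n)%N -> P n -> 0 <= a n <= C) ->
  (forall eta, 0 < eta -> exists n1, forall n, (n1 <= n)%N -> P n ->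
     exists N1, forall N, (N1 <= N)%N -> P N -> a n - eta <= a N) ->
  exists L, forall eta, 0 < eta ->
    exists n0, forall n, (n0 <= n)%N -> P n -> `|a n - L| < eta.
Proof.
move=> bnd key.
have [[n0 fin] | inf] := pselect (exists n0, forall n, (n0 <= n)%N -> ~ P n).
  by exists 0 => eta _; exists n0 => n /fin.
have {}inf n0 : exists2 n, (n0 <= n)%N & P n.
  apply: contrapT => h; apply: inf; exists n0 => n le_n Pn.
  by apply: h; exists n.
pose S : set R := [set x | exists N1, forall N, (N1 <= N)%N -> P N -> x <= a N].
have S0 : S 0 by exists 1%N => N N0 PN; have /andP[] := bnd N N0 PN.
have ubS : ubound S C.
  move=> x [N1 hx]; have [N le_N PN] := inf (maxn N1 1).
  apply: le_trans (hx N _ PN) _; first by lia.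
  by have /andP[] : 0 <= a N <= C by apply: bnd => //; lia.
have supS : has_sup S by split; [exists 0 | exists C].
exists (sup S) => eta eta0; have eta2 : 0 < eta / 2 by lra.
have [n1 h1] := key _ eta2.
have [x [N1 hx] ltx] := sup_adherent eta2 supS.
exists (maxn n1 N1) => n le_n Pn.
have le1 : a n - eta / 2 <= sup S.
  apply: sup_ubound; first by exists C.
  by apply: h1 => //; lia.
have le2 : x <= a n by apply: hx => //; lia.
by rewrite ltr_norml; apply/andP; split; lra.
Qed.

(** With [B = n z + N e], the sum [l z + l' e] is [s B] up to rounding errors [|z|] and [|e|], which
    leaves [sigma |B|] over. As [n |z|] is at most [(1 - delta) N |e|], this reserve is at least
    [Q = sigma delta N |e|], and [|z|], [|e|], [4 m n] are at most [Q / 4], [Q / 8], [Q / 2]. *)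
Lemma separation_ineq (R : realFieldType) (m n N K l l' s sigma delta z e : R) :
  0 < sigma -> 0 < delta -> 1 <= m -> 1 <= n -> 0 <= s <= 1 - sigma ->
  l <= s * n < l + 1 -> l' <= s * N < l' + 1 ->
  K * n <= (1 - delta) * N -> 4 <= sigma * delta * n ->
  8 * (m * n) <= sigma * delta * N -> 1 <= `|e| -> `|z| <= K ->
  `|l * z + l' * e| + 4 * (m * n) <= `|n * z + N * e|.
Proof.
move=> sig0 del0 m1 n1 /andP[s0 s1] /andP[l1 l2] /andP[l1' l2'] hK hn hN e1 zK.
set B := n * z + N * e.
have sd0 : 0 < sigma * delta by exact: mulr_gt0.
have mn1 : 1 <= m * n by rewrite -[1]mulr1 ler_pM.
have N0 : 0 < N by rewrite -(pmulr_rgt0 _ sd0); lra.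
have n0 : 0 < n by lra.
have z0 := normr_ge0 z.
have nz : n * `|z| <= (1 - delta) * N.
  by apply: le_trans hK; rewrite mulrC ler_wpM2r // ltW.
have nze : n * `|z| <= (1 - delta) * N * `|e|.
  apply: le_trans nz _; rewrite ler_peMr //; apply: le_trans hK.
  by apply: mulr_ge0; [exact: le_trans zK | exact: ltW].
have BE : delta * N * `|e| <= `|B|.
  have t1 : N * `|e| <= `|B| + n * `|z|.
    have -> : N * `|e| = `|N * e| by rewrite normrM (gtr0_norm N0).
    have -> : N * e = B - n * z by rewrite /B; ring.
    have -> : n * `|z| = `|n * z| by rewrite normrM (gtr0_norm n0).
    exact: ler_normB.
  by lra.
have AE : `|l * z + l' * e| <= (1 - sigma) * `|B| + `|z| + `|e|.
  have -> : l * z + l' * e = s * B - (s * n - l) * z - (s * N - l') * e.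
    by rewrite /B; ring.
  apply: le_trans (ler_normB _ _) _; apply: lerD; last first.
    by rewrite normrM ler_piMl // ger0_norm; lra.
  apply: le_trans (ler_normB _ _) _; apply: lerD; last first.
    by rewrite normrM ler_piMl // ger0_norm; lra.
  by rewrite normrM ger0_norm // ler_wpM2r.
pose Q := sigma * delta * N * `|e|.
have Qz : 4 * `|z| <= Q.
  apply: (@le_trans _ _ (sigma * delta * n * `|z|)); first by rewrite ler_wpM2r.
  rewrite /Q -!(mulrA (sigma * delta)) ler_wpM2l ?(ltW sd0) //.
  apply: le_trans nze _; rewrite -mulrA ler_piMl //; last by lra.
  by apply: mulr_ge0 => //; exact: ltW.
have Qe : 8 * `|e| <= Q by rewrite /Q ler_wpM2r //; lra.
have Qm : 8 * (m * n) <= Q.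
  apply: le_trans hN _; rewrite /Q ler_peMr //.
  by apply: mulr_ge0; exact: ltW.
have QB : Q <= sigma * `|B|.
  by rewrite /Q -!mulrA ler_wpM2l ?(ltW sig0) // mulrA.
have := normr_ge0 e; move: AE Qz Qe Qm QB; rewrite mulrBl mul1r.
by move: (sigma * `|B|) (m * n) `|B| `|z| `|e| `|_ + _| => b q bb zz ee aa; lra.
Qed.

Lemma separated_real (R : realType) (m n N K : nat) (l l' : 'I_m -> nat)
    (s : 'I_m -> R) (sigma delta : R) :
  0 < sigma -> 0 < delta -> (0 < m)%N -> (0 < n)%N ->
  (forall k, 0 <= s k <= 1 - sigma) ->
  (forall k, (l k)%:R <= s k * n%:R < (l k)%:R + 1) ->
  (forall k, (l' k)%:R <= s k * N%:R < (l' k)%:R + 1) ->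
  K%:R * n%:R <= (1 - delta) * N%:R ->
  4 <= sigma * delta * n%:R -> 8 * (m%:R * n%:R) <= sigma * delta * N%:R ->
  separated n N K l l'.
Proof.
move=> sig0 del0 m0 n0 hs hl hl' hK hn hN k Z E E0 ltZ.
have eE : 1 <= `|E%:~R| :> R by rewrite -intr_norm ler1z; lia.
have zK : `|Z%:~R| <= K%:R :> R.
  by rewrite -intr_norm -natr_absz ler_nat ltnW.
have := separation_ineq sig0 del0 (_ : 1 <= m%:R) (_ : 1 <= n%:R) (hs k) (hl k) (hl' k)
  hK hn hN eE zK.
rewrite !ler1n => /(_ m0 n0) h.
rewrite -(ler_nat R) natrD -mulnA !natrM !natr_absz !intr_norm !rmorphD !rmorphM /=.
exact: h.
Qed.

(** * Counts of model homomorphisms and their logarithms *)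

Definition floor_nat (R : realType) (m : nat) (s : 'rV[R]_m) (n : nat) (k : 'I_m) : nat :=
  `|Num.floor (s 0%R k * n%:R)%R|%N.

Lemma floor_natP (R : realType) (m : nat) (s : 'rV[R]_m) (n : nat) (k : 'I_m) :
  0 <= s 0 k ->
  (floor_nat s n k)%:R <= s 0 k * n%:R < (floor_nat s n k)%:R + 1.
Proof.
move=> s0; have f0 : 0 <= Num.floor (s 0 k * n%:R) by rewrite floor_ge0 mulr_ge0.
rewrite /floor_nat natr_absz (ger0_norm f0).
by have := floor_itv (s 0 k * n%:R); rewrite intrD.
Qed.

Definition mcount (m d n : nat) (l : 'I_m -> nat) : nat :=
  size (finmap.enum_fset (fset_set (@mslope_set m d n l))).

Lemma mcount_enum (m d n : nat) (l : 'I_m -> nat) : (0 < n)%N ->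
  exists e : 'I_(mcount d n l) -> ('rV[int]_m -> mvert d), enumerates (mslope_set n l) e.
Proof.
move=> n0; have [c [e /enumerates_finite fin _]] := mslope_set_enum d l n0.
by eexists; exact: enumerates_fset_set fin.
Qed.

Lemma mcount_le (m d n : nat) (l : 'I_m -> nat) : (0 < n)%N ->
  (mcount d n l <= 2 ^ m * d.+1 ^ (m * n) * d.+2 ^ (n ^ m))%N.
Proof.
move=> n0; have [c [e he le_c]] := mslope_set_enum d l n0.
by have [e' he'] := mcount_enum d l n0; apply: leq_trans (enumerates_le he' he) le_c.
Qed.

Lemma mcount_gt0 (m d n : nat) (l : 'I_m -> nat) : (0 < n)%N ->
  @mslope_set m d n l !=set0 -> (0 < mcount d n l)%N.
Proof.
move=> n0 [H hH]; have [e [_ /(_ H)[/(_ hH)[i _] _]]] := mcount_enum d l n0.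
exact: leq_ltn_trans (ltn_ord i).
Qed.

Section CountBounds.
Variables (R : realType) (m d : nat).
Hypothesis m2 : (2 <= m)%N.

Let B : R := ln d.+2%:R.

Let B_ge0 : 0 <= B. Proof. by rewrite ln_ge0 // ler1n. Qed.

Let ln_nat_le (a : nat) : (0 < a)%N -> (a <= d.+2)%N -> ln (a%:R : R) <= B.
Proof. by move=> a0 le; rewrite ler_ln ?posrE ?ltr0n ?ler_nat. Qed.

Let lnX_le (a b : nat) (x : R) : (0 < a)%N -> (a <= d.+2)%N -> b%:R <= x ->
  ln ((a ^ b)%N%:R : R) <= x * B.
Proof.
move=> a0 le lb; rewrite natrX lnXn ?ltr0n // -[ln _ *+ b]mulr_natl.
apply: le_trans (_ : b%:R * B <= _); last by rewrite ler_wpM2r.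
by rewrite ler_wpM2l ?ln_nat_le.
Qed.

Let lnM_nat (a b : nat) : (0 < a)%N -> (0 < b)%N ->
  ln ((a * b)%N%:R : R) = ln a%:R + ln b%:R.
Proof. by move=> a0 b0; rewrite natrM lnM // posrE ltr0n. Qed.

(** Each of the three factors contributes at most [m B n^(m-1)]; the word at the origin fits because
    [m >= 2] gives [n <= n^(m-1)]. *)
Lemma ln_glue_cost (n : nat) : (0 < n)%N ->
  ln (glue_cost m d n)%:R <= 3 * m%:R * B * n%:R ^+ m.-1.
Proof.
move=> n0; rewrite /glue_cost !lnM_nat ?muln_gt0 ?expn_gt0 //.
have n1 : 1 <= n%:R :> R by rewrite ler1n.
have nm1 : 1 <= n%:R ^+ m.-1 :> R by exact: exprn_ege1.
have nm : n%:R <= n%:R ^+ m.-1 :> R by rewrite -[X in X <= _]expr1 ler_weXn2l //; lia.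
have m0 : 0 <= m%:R :> R by [].
have h1 : ln ((2 ^ m)%N%:R : R) <= m%:R * n%:R ^+ m.-1 * B.
  by apply: lnX_le => //; rewrite ler_peMr.
have h2 : ln ((d.+1 ^ (m * n))%N%:R : R) <= m%:R * n%:R ^+ m.-1 * B.
  by apply: lnX_le => //; rewrite natrM ler_wpM2l.
have h3 : ln (((d.+2 ^ (n ^ m.-1)) ^ m)%N%:R : R) <= m%:R * n%:R ^+ m.-1 * B.
  by rewrite -expnM; apply: lnX_le => //; rewrite natrM natrX mulrC.
have -> : 3 * m%:R * B * n%:R ^+ m.-1 = 3 * (m%:R * n%:R ^+ m.-1 * B) :> R.
  by ring.
by lra.
Qed.

Lemma ln_mcount (n : nat) (l : 'I_m -> nat) : (0 < n)%N -> (0 < mcount d n l)%N ->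
  0 <= ln ((mcount d n l)%:R : R) <= (2 * m%:R + 1) * B * n%:R ^+ m.
Proof.
move=> n0 c0; rewrite ln_ge0 ?ler1n //=.
apply: (@le_trans _ _ (ln ((2 ^ m * d.+1 ^ (m * n) * d.+2 ^ (n ^ m))%N%:R : R))).
  by rewrite ler_ln ?posrE ?ltr0n ?ler_nat ?muln_gt0 ?expn_gt0 ?mcount_le.
rewrite !lnM_nat ?muln_gt0 ?expn_gt0 //.
have n1 : 1 <= n%:R :> R by rewrite ler1n.
have nm1 : 1 <= n%:R ^+ m :> R by exact: exprn_ege1.
have nm : n%:R <= n%:R ^+ m :> R by rewrite -[X in X <= _]expr1 ler_weXn2l //; lia.
have m0 : 0 <= m%:R :> R by [].
have h1 : ln ((2 ^ m)%N%:R : R) <= m%:R * n%:R ^+ m * B.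
  by apply: lnX_le => //; rewrite ler_peMr.
have h2 : ln ((d.+1 ^ (m * n))%N%:R : R) <= m%:R * n%:R ^+ m * B.
  by apply: lnX_le => //; rewrite natrM ler_wpM2l.
have h3 : ln ((d.+2 ^ (n ^ m))%N%:R : R) <= n%:R ^+ m * B.
  by apply: lnX_le => //; rewrite natrX.
have -> : (2 * m%:R + 1) * B * n%:R ^+ m =
  m%:R * n%:R ^+ m * B + m%:R * n%:R ^+ m * B + n%:R ^+ m * B :> R by ring.
by lra.
Qed.

End CountBounds.

Lemma bernoulli_ge (R : realFieldType) (x : R) (m : nat) :
  0 <= x <= 1 -> 1 - m%:R * x <= (1 - x) ^+ m.
Proof.
move=> /andP[x0 x1]; elim: m => [|m IH]; first by rewrite expr0; lra.
rewrite exprS; apply: (@le_trans _ _ ((1 - x) * (1 - m%:R * x))); last first.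
  by rewrite ler_wpM2l // subr_ge0.
rewrite -natr1; have : 0 <= m%:R * (x * x) by rewrite !mulr_ge0.
have -> : (1 - x) * (1 - m%:R * x) = 1 - (m%:R + 1) * x + m%:R * (x * x) by ring.
by lra.
Qed.

Lemma nat_above (R : realType) (x : R) : exists n0, forall n, (n0 <= n)%N -> x <= n%:R.
Proof.
exists (Num.bound `|x|) => n le_n; apply: (@le_trans _ _ (Num.bound `|x|)%:R); last by rewrite ler_nat.
exact: le_trans (ler_norm x) (ltW (archi_boundP _)).
Qed.

Lemma coord_le_l1norm (R : realType) (m : nat) (s : 'rV[R]_m) (k : 'I_m) :
  s 0 k <= l1norm s.
Proof.
rewrite /l1norm (bigD1 k) //=; apply: le_trans (ler_norm _) _.
by rewrite lerDl sumr_ge0.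
Qed.

Definition mentropy (R : realType) (m d : nat) (s : 'rV[R]_m) (n : nat) : R :=
  ln (mcount d n (floor_nat s n))%:R / n%:R ^+ m.

Definition madmissible (R : realType) (m d : nat) (s : 'rV[R]_m) (n : nat) : Prop :=
  @mslope_set m d n (floor_nat s n) !=set0.

(** [k] is the number of cells per side, [x] the logarithm of the number of fillings, [e] that of
    the gluing cost. By Bernoulli the volume fraction [(k n / N)^m] is at least [1 - 2 w] with
    [w = m delta]; this loss and the surface loss [e / n^m] each take at most [eta / 2]. *)
Lemma scaled_count_le (R : realFieldType) (m : nat) (n N k x c c' e delta eta C1 C2 : R) :
  (0 < m)%N -> 0 < n -> 0 < N -> 0 <= x -> 0 <= C2 -> 0 < eta ->
  delta = eta / (4 * m%:R * (C2 + 1 + eta)) ->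
  C1 * 2 <= eta * n -> n <= delta * N ->
  (1 - delta) * N < (k + 1) * n -> 0 <= k ->
  c <= C2 * n ^+ m -> c <= x + e -> e <= C1 * n ^+ m.-1 -> k ^+ m * x <= c' ->
  c / n ^+ m - eta <= c' / N ^+ m.
Proof.
move=> m0 n0 N0 x0 C20 eta0 edelta hC1 hN hk k0 hc hce he hc'.
have mR : 1 <= m%:R :> R by rewrite ler1n.
have D0 : 0 < 4 * m%:R * (C2 + 1 + eta) by rewrite !mulr_gt0 //; lra.
have d0 : 0 < delta by rewrite edelta divr_gt0.
have md : 4 * (m%:R * delta) * (C2 + 1 + eta) = eta.
  have -> : 4 * (m%:R * delta) * (C2 + 1 + eta) = delta * (4 * m%:R * (C2 + 1 + eta)).
    by ring.
  by rewrite edelta divfK // gt_eqF.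
set w := m%:R * delta in md; have w0 : 0 < w by rewrite /w mulr_gt0 //; lra.
have wC : 4 * w * C2 <= eta by rewrite -md ler_wpM2l; lra.
have w1 : 4 * w <= 1.
  rewrite -(ler_pM2r (_ : 0 < C2 + 1 + eta)); last by lra.
  by rewrite md mul1r; lra.
have dw : delta <= w by rewrite /w ler_peMl // ltW.
pose q := k * n / N.
have q1 : 1 - 2 * delta <= q.
  rewrite /q ler_pdivlMr //; move: hk hN; rewrite mulrDl mul1r; lra.
have qm : 1 - 2 * w <= q ^+ m.
  have := @bernoulli_ge R (2 * delta) m; rewrite (_ : m%:R * (2 * delta) = 2 * w); last first.
    by rewrite /w; ring.
  move=> h; apply: (@le_trans _ _ ((1 - 2 * delta) ^+ m)); first by apply: h; lra.
  by apply: lerXn2r => //; rewrite nnegrE ?(le_trans _ q1) //; lra.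
have nm0 : 0 < n ^+ m by exact: exprn_gt0.
have Nm0 : 0 < N ^+ m by exact: exprn_gt0.
pose Y := x / n ^+ m.
have Y0 : 0 <= Y by rewrite /Y divr_ge0 // ltW.
have aN : q ^+ m * Y <= c' / N ^+ m.
  have -> : q ^+ m * Y = k ^+ m * x / N ^+ m.
    by rewrite /q /Y !exprMn exprVn; field; rewrite !gt_eqF.
  by rewrite ler_wpM2r // invr_ge0 ltW.
have an : c / n ^+ m <= C2 by rewrite ler_pdivrMr.
have an' : c / n ^+ m - eta / 2 <= Y.
  rewrite lerBlDr -(ler_pM2r nm0) mulrDl /Y !divfK ?gt_eqF //.
  apply: le_trans hce _; rewrite lerD2l; apply: le_trans he _.
  rewrite -{2}(prednK m0) exprS mulrA ler_wpM2r ?exprn_ge0 ?(ltW n0) //.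
  by lra.
apply: le_trans aN; apply: (@le_trans _ _ ((1 - 2 * w) * Y)); last by rewrite ler_wpM2r.
move: eta0 wC w1 w0 an an' Y0; clearbody Y w; clear.
move: (c / _) => a eta0 wC w1 w0 an an' Y0.
(* No upper bound on [Y] is given; above [C2] the bound [a <= C2] replaces it. *)
have [YC | CY] := leP Y C2.
  have : w * Y <= w * C2 by rewrite ler_wpM2l // ltW.
  by rewrite mulrBl mul1r -mulrA; lra.
have : (1 - 2 * w) * C2 <= (1 - 2 * w) * Y by rewrite ler_wpM2l ?(ltW CY) //; lra.
by rewrite !mulrBl !mul1r -!mulrA; lra.
Qed.

Lemma mentropy_limit (R : realType) (m d : nat) (s : 'rV[R]_m) : (2 <= m)%N ->
  (forall k, 0 <= s 0 k) -> l1norm s < 1 ->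
  exists L, forall eta, 0 < eta ->
    exists n0, forall n, (n0 <= n)%N -> madmissible d s n -> `|mentropy d s n - L| < eta.
Proof.
move=> m2 s0 s1; pose B : R := ln d.+2%:R; pose C2 := (2 * m%:R + 1) * B.
have B0 : 0 <= B by rewrite ln_ge0 // ler1n.
have m0 : (0 < m)%N by lia.
have mR : 1 <= m%:R :> R by rewrite ler1n.
have C20 : 0 <= C2 by rewrite mulr_ge0 //; lra.
have cnt_bounds n : (0 < n)%N -> madmissible d s n ->
    0 <= ln ((mcount d n (floor_nat s n))%:R : R) <= C2 * n%:R ^+ m.
  by move=> n0 Pn; apply: ln_mcount => //; exact: mcount_gt0.
apply: (@almost_monotone_limit _ _ _ C2).
  move=> n n0 Pn; have /andP[h1 h2] := cnt_bounds n n0 Pn.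
  have nm0 : 0 < n%:R ^+ m :> R by rewrite exprn_gt0 // ltr0n.
  by rewrite /mentropy divr_ge0 ?ler_pdivrMr // ltW.
(* [sigma] keeps every coordinate of [s] away from 1, and [delta] is chosen so that the margin costs
   at most [eta / 2]. *)
move=> eta eta0; pose sigma := 1 - l1norm s; have sig0 : 0 < sigma by rewrite subr_gt0.
pose delta := eta / (4 * m%:R * (C2 + 1 + eta)).
have D0 : 0 < 4 * m%:R * (C2 + 1 + eta) by rewrite !mulr_gt0 //; lra.
have del0 : 0 < delta by rewrite divr_gt0.
have del1 : delta <= 1 / 2.
  rewrite ler_pdivrMr //.
  have -> : 1 / 2 * (4 * m%:R * (C2 + 1 + eta)) = 2 * (m%:R * (C2 + 1 + eta)) by field.
  by have : C2 + 1 + eta <= m%:R * (C2 + 1 + eta) by [rewrite ler_peMl //; lra]; lra.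
have edelta : delta = eta / (4 * m%:R * (C2 + 1 + eta)) by [].
clearbody delta; have sd0 : 0 < sigma * delta by exact: mulr_gt0.
have [n1 hn1] := nat_above (4 / (sigma * delta)).
have [n2 hn2] := nat_above (3 * m%:R * B * 2 / eta).
exists (maxn 1 (maxn n1 n2)) => n le_n Pn.
have [n0 le_n1 le_n2] : [/\ (0 < n)%N, (n1 <= n)%N & (n2 <= n)%N].
  by move: le_n; rewrite !geq_max => /andP[-> /andP[-> ->]].
have nR : 0 < n%:R :> R by rewrite ltr0n.
have [N1 hN1] := nat_above (8 * (m%:R * n%:R) / (sigma * delta)).
have [N2 hN2] := nat_above (n%:R / delta).
exists (maxn 1 (maxn N1 N2)) => N le_N PN.
have [N0 le_N1 le_N2] : [/\ (0 < N)%N, (N1 <= N)%N & (N2 <= N)%N].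
  by move: le_N; rewrite !geq_max => /andP[-> /andP[-> ->]].
have NR : 0 < N%:R :> R by rewrite ltr0n.
have hnN : n%:R <= delta * N%:R.
  by rewrite -ler_pdivrMl // mulrC; exact: hN2.
(* The largest number of cells of side [n] fitting in [(1 - delta) N]. *)
pose K := Num.truncn ((1 - delta) * N%:R / n%:R).
have x0 : 0 <= (1 - delta) * N%:R / n%:R.
  by rewrite divr_ge0 ?mulr_ge0 ?ltW //; lra.
have /andP[K1 K2] := truncn_itv x0; rewrite -/K in K1 K2.
rewrite ler_pdivlMr // in K1; rewrite ltr_pdivrMr // -natr1 in K2.
have K0 : (0 < K)%N.
  rewrite lt0n; apply/eqP => K0; move: K2; rewrite K0 add0r mul1r.
  have : delta * N%:R <= (1 - delta) * N%:R by rewrite ler_wpM2r ?(ltW NR) //; lra.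
  by lra.
have leKN : (K * n <= N)%N.
  by rewrite -(ler_nat R) natrM; apply: le_trans K1 _; rewrite ler_piMl //; lra.
have [e he] := mcount_enum d (floor_nat s n) n0.
have [e' he'] := mcount_enum d (floor_nat s N) N0.
have sk1 k : s 0 k <= 1 - sigma by rewrite /sigma subKr coord_le_l1norm.
have sep : separated n N K (floor_nat s n) (floor_nat s N).
  apply: (separated_real (s := fun k => s 0 k) sig0 del0 m0 n0) => //.
  - by move=> k; rewrite s0 sk1.
  - by move=> k; exact: floor_natP.
  - by move=> k; exact: floor_natP.
  - by rewrite -ler_pdivrMl // mulrC; exact: hn1.
  by rewrite -ler_pdivrMl // mulrC; exact: hN1.
have le_l k : (floor_nat s n k <= n)%N.
  have /andP[h _] := floor_natP n (s0 k); rewrite -(ler_nat R); apply: le_trans h _.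
  by rewrite ler_piMl //; have := sk1 k; lra.
have par k : odd (floor_nat s N k) = odd N.
  by have [H [eps hH]] := PN; exact: mset_parity hH.
have c0 := mcount_gt0 n0 Pn; have c0' := mcount_gt0 N0 PN.
have [F [hF1 hF2]] := mslope_gluing m0 n0 K0 leKN le_l sep par c0 he he'.
have F0 : (0 < F)%N by case: F hF1 {hF2} => //; rewrite mul0n leqNgt c0.
have E0 : (0 < glue_cost m d n)%N by rewrite /glue_cost !muln_gt0 !expn_gt0.
apply: (scaled_count_le (x := ln F%:R) (k := K%:R) (delta := delta)
  (e := ln (glue_cost m d n)%:R) (C1 := 3 * m%:R * B) (C2 := C2) m0) => //.
- by rewrite ln_ge0 // ler1n.
- by rewrite -ler_pdivrMl // mulrC; exact: hn2.
- by have /andP[] := cnt_bounds n n0 Pn.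
- have FE0 : (0 < F * glue_cost m d n)%N by rewrite muln_gt0 F0.
  by rewrite -lnM ?posrE ?ltr0n // -natrM ler_ln ?posrE ?ltr0n // ler_nat.
- exact: ln_glue_cost.
rewrite -natrX mulr_natl -lnXn ?ltr0n // -natrX ler_ln ?posrE ?ltr0n ?expn_gt0 ?F0 //.
by rewrite ler_nat.
Qed.

(** * Coordinates along a periodic geodesic *)

Lemma foldr_lmul_word (d : nat) (x : vertex d) (i : 'I_d) (w : seq 'I_d) :
  foldr (@lmul d) x (lmul_word i w) = lmul i (foldr (@lmul d) x w).
Proof.
case: w => [|j w] //=; have [-> | _] := eqVneq i j; last by [].
by rewrite lmulK.
Qed.

Lemma foldr_lmul_root (d : nat) (v : vertex d) :
  foldr (@lmul d) (tree_root d) (val v) = v.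
Proof.
case: v => w rw; rewrite /=; elim: w rw => [|i w IH] rw; first exact: val_inj.
rewrite /= (IH (path_sorted rw)); apply: val_inj => /=.
by case: w rw {IH} => [|j w] //= /andP[/negbTE->].
Qed.

Lemma foldr_lmul_rev (d : nat) (p : seq 'I_d) (x : vertex d) :
  foldr (@lmul d) (foldr (@lmul d) x p) (rev p) = x.
Proof.
elim: p x => [|i p IH] x //=.
by rewrite rev_cons foldr_rcons lmulK IH.
Qed.

Lemma lmul_inj_letter (d : nat) (i j : 'I_d) (v : vertex d) : lmul i v = lmul j v -> i = j.
Proof.
case: v => w rw /(congr1 val) /=; case: w rw => [|k w] _ /=; first by case.
have [-> | ik] := eqVneq i k; have [-> | jk] := eqVneq j k => //.
- by move/(congr1 size) => /=; lia.
- by move/(congr1 size) => /=; lia.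
by case.
Qed.

Lemma lmul_neq (d : nat) (i : 'I_d) (v : vertex d) : lmul i v <> v.
Proof.
case: v => w rw /(congr1 (fun v => size (val v))) /=.
by case: w rw => [|k w] _ //=; case: ifP => _ /=; lia.
Qed.

Lemma colour_lmul (d : nat) (i : 'I_d) (v : vertex d) : colour v (lmul i v) = Some i.
Proof.
rewrite /colour; case: pickP => [j /eqP/lmul_inj_letter -> //|/(_ i)].
by rewrite eqxx.
Qed.

Lemma colourP (d : nat) (i : 'I_d) (v w : vertex d) : colour v w = Some i -> w = lmul i v.
Proof. by rewrite /colour; case: pickP => // j /eqP -> [->]. Qed.

Lemma tdist_le (d : nat) (u : vertex d) (p : seq 'I_d) :
  (tdist u (foldr (@lmul d) u p) <= size p)%N.
Proof.
rewrite /tdist; case: ex_minnP => k _; apply.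
by apply/existsP; exists (in_tuple p).
Qed.

Lemma tdist_walk (d : nat) (u v : vertex d) :
  exists2 p : seq 'I_d, size p = tdist u v & foldr (@lmul d) u p = v.
Proof.
rewrite /tdist; case: ex_minnP => k /existsP[p /eqP pv] _.
by exists p; rewrite ?size_tuple.
Qed.

(** Supplies lower bounds on [tdist], as [tdist_le] supplies upper bounds. *)
Lemma tdist_lipschitz (d : nat) (phi : vertex d -> int) (u v : vertex d) :
  (forall i w, (`|(phi (lmul i w) - phi w)%R| <= 1)%N) ->
  (`|(phi u - phi v)%R| <= tdist u v)%N.
Proof.
move=> lip; have [p <- <-] := tdist_walk u v.
elim: p => [|i p] /=; first by rewrite subrr.
have := lip i (foldr (@lmul d) u p).
by move: (phi _) (phi _) (phi _) => a b c; lia.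
Qed.

Lemma tdist_sym (d : nat) (u v : vertex d) : tdist u v = tdist v u.
Proof.
have le (x y : vertex d) : (tdist x y <= tdist y x)%N.
  have [p <- <-] := tdist_walk y x; rewrite -(size_rev p).
  by rewrite -{2}(foldr_lmul_rev p y); exact: tdist_le.
by apply/eqP; rewrite eqn_leq !le.
Qed.

Lemma tdist0 (d : nat) (u v : vertex d) : tdist u v = 0%N -> u = v.
Proof. by have [p <- <-] := tdist_walk u v; move/size0nil ->. Qed.

Lemma tdist_lmul (d : nat) (i : 'I_d) (u v : vertex d) :
  (tdist u (lmul i v) <= (tdist u v).+1)%N.
Proof. by have [p <- <-] := tdist_walk u v; exact: (tdist_le u (i :: p)). Qed.

Lemma tdist1P (d : nat) (u v : vertex d) :
  tdist u v = 1%N <-> exists i, v = lmul i u.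
Proof.
split=> [|[i ->]].
  by have [[|i [|j p]] <- <- //] := tdist_walk u v; exists i.
have := tdist_le u [:: i] => /=; case E : (tdist _ _) => [|[|k]] //.
by move/tdist0/esym/lmul_neq: E.
Qed.

(** Two transpositions carry [a] to 0 and [b] to 1, as the convention behind [mvalid] requires. *)
Lemma relabel_ex (d : nat) (a b : 'I_d) : a != b ->
  exists s : {perm 'I_d}, forall i, (s i < 2)%N = (i == a) || (i == b).
Proof.
move=> ab; have d1 : (1 < d)%N.
  rewrite ltnNge; apply: contraNN ab => le; apply/eqP/val_inj => /=.
  by have := ltn_ord a; have := ltn_ord b; lia.
pose i0 := Ordinal (ltnW d1); pose i1 := Ordinal d1.
have i01 : i0 != i1 by [].
pose t := tperm a i0; pose s := (t * tperm (t b) i1)%g.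
have ta : t a = i0 by exact: tpermL.
have tb : t b != i0 by rewrite -ta (inj_eq (@perm_inj _ t)) eq_sym.
have sa : s a = i0.
  by rewrite permM ta tpermD // eq_sym.
have sb : s b = i1 by rewrite permM tpermL.
exists s => i; rewrite -(inj_eq (@perm_inj _ s)) sa -[i == b](inj_eq (@perm_inj _ s)) sb.
by case: (s i) => [[|[|u]] hu].
Qed.

Lemma madj_distance (d : nat) (v w : mvert d) (i : int) : madj v w ->
  (`|(((size w.2)%:Z + `|w.1 - i|) - ((size v.2)%:Z + `|v.1 - i|))%R| <= 1)%N.
Proof.
have step (u : mvert d) : (`|(((size (mpar u).2)%:Z + `|(mpar u).1 - i|) -
    ((size u.2)%:Z + `|u.1 - i|))%R| <= 1)%N.
  by case: u => j [|x c]; rewrite /mpar /=; lia.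
by case=> ->; [|rewrite distnC]; exact: step.
Qed.

Lemma commuting_foldr (d : nat) (theta : vertex d -> vertex d) (p : seq 'I_d) (v : vertex d) :
  (forall i v, theta (lmul i v) = lmul i (theta v)) ->
  theta (foldr (@lmul d) v p) = foldr (@lmul d) (theta v) p.
Proof. by move=> th; elim: p => //= i p IH; rewrite th IH. Qed.

(** Left multiplications connect the tree, so a map commuting with them, a right translation, is
    determined by one value. *)
Lemma commuting_ext (d : nat) (theta theta' : vertex d -> vertex d) (u v : vertex d) :
  (forall i v, theta (lmul i v) = lmul i (theta v)) ->
  (forall i v, theta' (lmul i v) = lmul i (theta' v)) ->
  theta u = theta' u -> theta v = theta' v.
Proof.
by move=> th th' e; have [p _ <-] := tdist_walk u v; rewrite !commuting_foldr // e.
Qed.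

(* The right translation of the Cayley graph that sends [u] to [v], at [w]. *)
Definition translate (d : nat) (u v w : vertex d) : vertex d :=
  foldr (@lmul d) v (val w ++ rev (val u)).

Lemma translate_lmul (d : nat) (u v : vertex d) (i : 'I_d) (w : vertex d) :
  translate u v (lmul i w) = lmul i (translate u v w).
Proof. by rewrite /translate !foldr_cat /= foldr_lmul_word. Qed.

Lemma translate_id (d : nat) (u v : vertex d) : translate u v u = v.
Proof.
by rewrite /translate foldr_cat; have := foldr_lmul_rev (rev (val u)) v; rewrite revK.
Qed.

Lemma translateK (d : nat) (u v w : vertex d) : translate v u (translate u v w) = w.
Proof.
apply: (@commuting_ext _ (fun w => translate v u (translate u v w)) id u) => //.
  by move=> i x; rewrite !translate_lmul.
by rewrite !translate_id.
Qed.

(** A repeated letter would cancel and shorten the walk. *)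
Lemma geodesic_walk_reduced (d : nat) (u : vertex d) (q : seq 'I_d) :
  tdist u (foldr (@lmul d) u q) = size q -> reduced q.
Proof.
elim: q => //= x q IH e.
have tq : tdist u (foldr (@lmul d) u q) = size q.
  apply/eqP; rewrite eqn_leq tdist_le -ltnS -e; exact: tdist_lmul.
have := IH tq; case: q e {IH tq} => [|y q] //= e; rewrite /reduced /= => ->.
rewrite andbT; apply: contra_eqN e => /eqP ->; rewrite lmulK.
by have := tdist_le u q; lia.
Qed.

Lemma val_foldr_root (d : nat) (q : seq 'I_d) :
  reduced q -> val (foldr (@lmul d) (tree_root d) q) = q.
Proof. by move=> rq; have := foldr_lmul_root (exist _ q rq) => ->. Qed.

Lemma bool_crossing (f : nat -> bool) (n : nat) : f 0%N != f n ->
  exists2 t, (t < n)%N & f t != f t.+1.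
Proof.
elim: n => [|n IH]; first by rewrite eqxx.
have [fn | fn] := eqVneq (f n) (f n.+1); last by exists n.
by rewrite -fn => /IH[t lt ft]; exists t => //; exact: leqW.
Qed.

(** * Lattice homomorphisms into the Cayley tree *)

Lemma l1norm_l1dist (m : nat) (x y : 'rV[int]_m) : l1norm (x - y) = (l1dist x y)%:Z.
Proof.
rewrite /l1norm /l1dist -natz natr_sum; apply: eq_bigr => k _.
by rewrite !mxE natz abszE.
Qed.

Lemma lattice_adjP (m : nat) (x y : 'rV[int]_m) :
  lattice_adj x y <-> exists k, y = x + e_ k \/ x = y + e_ k.
Proof.
rewrite /lattice_adj l1norm_l1dist; split=> [e1 | [k [->|->]]]; last first.
- by rewrite l1dist_adj.
- by rewrite l1dist_sym l1dist_adj.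
have {}e1 : l1dist x y = 1%N by lia.
have [k neq] : exists k, x 0 k != y 0 k.
  apply/existsP; apply: contra_eqT e1; rewrite negb_exists => /forallP h.
  have -> : x = y by apply/rowP => k; apply/eqP; have := h k; rewrite negbK.
  by rewrite l1dist_xx.
exists k; have [ltk | gtk] := ltP (x 0 k) (y 0 k).
  left; apply/esym/l1dist0P; have := l1dist_step x y k 1; rewrite basis_scale1 e1.
  by move: (l1dist _ _) (x 0 k) (y 0 k) ltk; clear => a u v ltk; lia.
right; apply: l1dist0P; have := l1dist_step y x k 1; rewrite basis_scale1 (l1dist_sym y x) e1.
rewrite l1dist_sym; move: (l1dist _ _) (x 0 k) (y 0 k) neq gtk; clear => a u v neq gtk.
by lia.
Qed.

Lemma graph_homP (m d : nat) (h : 'rV[int]_m -> vertex d) :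
  graph_hom h <-> forall x k, exists i, h (x + e_ k) = lmul i (h x).
Proof.
split=> [hom x k | step x y /lattice_adjP[k [->|->]]].
- by apply/tdist1P/hom/lattice_adjP; exists k; left.
- exact/tdist1P/step.
by rewrite tdist_sym; exact/tdist1P/step.
Qed.

(** Invariance of the colours says that the shift commutes with every step [alpha_i], so on values
    it acts as a right translation of the group. *)
Lemma translation_map (m d n : nat) (h : 'rV[int]_m -> vertex d) (k : 'I_m) :
  graph_hom h -> translation_invariant n h ->
  exists2 theta : vertex d -> vertex d,
    (forall i v, theta (lmul i v) = lmul i (theta v)) &
    forall x, h (x + e_ k *+ n) = theta (h x).
Proof.
move=> /graph_homP hom inv; exists (translate (h 0) (h (0 + e_ k *+ n))).
  exact: translate_lmul.
have step x j i : h (x + e_ j) = lmul i (h x) ->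
    h (x + e_ j + e_ k *+ n) = lmul i (h (x + e_ k *+ n)).
  move=> hx; have := inv x (x + e_ j); rewrite /dual_map hx colour_lmul.
  have adj : lattice_adj x (x + e_ j) by apply/lattice_adjP; exists j; left.
  by move=> /(_ adj k)/esym/colourP.
elim/(@lattice_walk_ind m 0) => [|x j IH _|x j IH _].
- by rewrite translate_id.
- by have [i hi] := hom x j; rewrite (step _ _ _ hi) hi translate_lmul IH.
have [i hi] := hom x j; have := step _ _ _ hi; rewrite IH hi translate_lmul.
by move/(congr1 (@lmul d i)); rewrite !lmulK.
Qed.

(* The line from [x] to its translate runs through the first edge of the
   geodesic joining the two images. *)
Lemma hom_first_edge (m d n : nat) (h : 'rV[int]_m -> vertex d) (k : 'I_m)
    (x : 'rV[int]_m) (i : 'I_d) (q : seq 'I_d) :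
  graph_hom h -> reduced (rcons q i) ->
  h (x + e_ k *+ n) = foldr (@lmul d) (h x) (rcons q i) ->
  exists y, h y = lmul i (h x).
Proof.
move=> /graph_homP hom red hq.
pose T := translate (h x) (tree_root d).
(* [P v] says that the geodesic from [h x] to [v] starts with the edge coloured [i], words being
   read from the last letter; it can change only across that edge. *)
pose P v := let w := val (T v) in if w is a :: w' then last a w' == i else false.
have [t _] : exists2 t, (t < n)%N & P (h (x + e_ k *+ t)) != P (h (x + e_ k *+ t.+1)).
  apply: bool_crossing; rewrite mulr0n addr0 hq /P /T translate_id /=.
  rewrite commuting_foldr; last exact: translate_lmul.
  rewrite translate_id val_foldr_root //; case: q {hq red} => [|a q] /=.
    by rewrite eqxx.
  by rewrite last_rcons eqxx.
rewrite mulrSr addrA; set y := x + e_ k *+ t; have [j hj] := hom y k.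
have Tinj v : val (T v) = [:: i] -> v = lmul i (h x).
  move=> e; rewrite -(translateK (h x) (tree_root d) v) -/(T v).
  have -> : T v = lmul i (tree_root d) by apply: val_inj.
  by rewrite translate_lmul translate_id.
have TE : val (T (h (y + e_ k))) = lmul_word j (val (T (h y))).
  by rewrite hj /T translate_lmul.
rewrite /P TE; case E : (val (T (h y))) => [|a [|b w]] /=.
- have [ji _ | //] := eqVneq j i; exists (y + e_ k); apply: Tinj.
  by rewrite TE E /= ji.
- case: ifP => /= [_ | _]; last by rewrite eqxx.
  by have [ai _ | //] := eqVneq a i; exists y; apply: Tinj; rewrite E ai.
by case: ifP => _ /=; rewrite eqxx.
Qed.

Lemma Hset_floor (R : realType) (m d n : nat) (g : int -> vertex d) (s : 'rV[R]_m)
    (h : 'rV[int]_m -> vertex d) (k : 'I_m) : (0 < n)%N -> Hset g s n h ->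
  Num.floor (s 0 k * n%:R) = (min_shift_dist n h k)%:Z.
Proof.
move=> n0 [_ _ hslope _ _].
move/rowP/(_ k): hslope; rewrite !mxE => /(congr1 (fun x => x * n%:R)).
by rewrite !divfK ?pnatr_eq0 -?lt0n // pmulrn => /intr_inj.
Qed.

(** * The dictionary between the Cayley tree and the model tree *)

Section Coordinates.
Variables (d : nat) (g : int -> vertex d) (col : int -> 'I_d) (rl : int -> {perm 'I_d}).
Hypothesis gcol : forall j, g (j + 1) = lmul (col j) (g j).
Hypothesis col_ne : forall j, col j != col (j - 1).
Hypothesis g0 : g 0 = tree_root d.
Hypothesis rl_lt : forall j i, (rl j i < 2)%N = (i == col j) || (i == col (j - 1)).

(** Left multiplication by [alpha_i], transported to the model tree. *)
Definition mact (i : 'I_d) (v : mvert d) : mvert d :=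
  if v.2 is x :: c then if rl v.1 i == x then (v.1, c) else (v.1, rl v.1 i :: v.2)
  else if i == col v.1 then (v.1 + 1, [::])
  else if i == col (v.1 - 1) then (v.1 - 1, [::]) else (v.1, [:: rl v.1 i]).

Definition mvertex (v : mvert d) : vertex d :=
  foldr (@lmul d) (g v.1) (map (rl v.1)^-1%g v.2).

Definition mcoord (v : vertex d) : mvert d := foldr mact (0, [::]) (val v).

Lemma gcol_pred j : g (j - 1) = lmul (col (j - 1)) (g j).
Proof. by have := gcol (j - 1); rewrite subrK => ->; rewrite lmulK. Qed.

Lemma mvertex_act i v : mvertex (mact i v) = lmul i (mvertex v).
Proof.
case: v => j [|x c]; rewrite /mvertex /mact /=.
  have [-> | _] := eqVneq i (col j); first by rewrite /= gcol.
  have [-> | _] := eqVneq i (col (j - 1)); first by rewrite /= gcol_pred.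
  by rewrite /= permK.
have [<- | _] /= := eqVneq; first by rewrite permK lmulK.
by rewrite permK.
Qed.

Lemma mcoordK v : mvertex (mcoord v) = v.
Proof.
rewrite /mcoord -[RHS]foldr_lmul_root; elim: (val v) => [|i w IH] /=.
  by rewrite /mvertex /= g0.
by rewrite mvertex_act IH.
Qed.

Lemma mact_valid i v : mvalid v.2 -> mvalid (mact i v).2.
Proof.
case: v => j [|x c]; rewrite /mact /=.
  have [// | ni] := eqVneq i (col j); have [// | ni'] := eqVneq i (col (j - 1)).
  by move=> _; rewrite /mvalid /= ltnNge -ltnS rl_lt negb_or ni ni'.
have [_ | ne] /= := eqVneq.
  by case: c => [|y c] //; rewrite /mvalid /= => /andP[/andP[_ ->] ->].
by rewrite /mvalid /= ne => /andP[-> ->].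
Qed.

Lemma mactK i v : mvalid v.2 -> mact i (mact i v) = v.
Proof.
case: v => j [|x c]; rewrite /mact /=.
  have [-> _ | ni _] /= := eqVneq i (col j).
    have := col_ne (j + 1); rewrite addrK eq_sym => /negbTE ->.
    by rewrite eqxx.
  have [-> | ni'] /= := eqVneq i (col (j - 1)); last by rewrite eqxx.
  by rewrite eqxx subrK.
have [xE | ne] /= := eqVneq; last by rewrite eqxx.
case: c => [|y c]; rewrite /mvalid /=; last first.
  by case/andP=> /andP[xy _] _; rewrite xE (negbTE xy).
rewrite -xE ltnNge -ltnS rl_lt negb_or => /andP[ni ni'].
by rewrite (negbTE ni) (negbTE ni').
Qed.

Lemma mcoord_valid v : mvalid (mcoord v).2.
Proof. by rewrite /mcoord; elim: (val v) => [|i w IH] //=; exact: mact_valid. Qed.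

(** When [alpha_i] cancels the first letter, [mact i] has to undo itself, which [mactK] ensures on
    valid coordinates. *)
Lemma mcoord_lmul i v : mcoord (lmul i v) = mact i (mcoord v).
Proof.
case: v => w rw; rewrite /mcoord /=; case: w rw => [|j w] rw //=.
have [-> | _] := eqVneq i j; last by [].
by rewrite mactK //; have := mcoord_valid (exist (fun w => reduced w) w (path_sorted rw)).
Qed.

Lemma mcoord_geodesic j : mcoord (g j) = (j, [::]).
Proof.
have up (k : nat) : mcoord (g k%:Z) = (k%:Z, [::]).
  elim: k => [|k IH]; first by rewrite g0.
  by rewrite -addn1 PoszD gcol mcoord_lmul IH /mact /= eqxx.
have down (k : nat) : mcoord (g (- k%:Z)) = (- k%:Z, [::]).
  elim: k => [|k IH]; first by rewrite oppr0 g0.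
  rewrite -addn1 PoszD opprD gcol_pred mcoord_lmul IH /mact /=.
  by rewrite eq_sym (negbTE (col_ne _)) eqxx.
by case: (intP j) => [|k|k]; [exact: (up 0%N) | exact: up | exact: down].
Qed.

Lemma mvertexK v : mvalid v.2 -> mcoord (mvertex v) = v.
Proof.
case: v => j c; rewrite /mvertex /=; elim: c => [|x c IH] /=.
  by rewrite mcoord_geodesic.
move=> vxc; rewrite mcoord_lmul IH; last first.
  by move: vxc; case: c {IH} => [|y c] //; rewrite /mvalid /= => /andP[/andP[_ ->] ->].
rewrite /mact /= permKV; case: c {IH} vxc => [|y c]; rewrite /mvalid /=; last first.
  by case/andP => /andP[/negbTE -> _].
move=> x2; have := rl_lt j ((rl j)^-1%g x); rewrite permKV [(x < 2)%N]ltnNge x2.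
by move/esym/negbT; rewrite negb_or => /andP[/negbTE -> /negbTE ->].
Qed.

Lemma mact_adj i v : madj v (mact i v).
Proof.
case: v => j [|x c]; rewrite /mact /=.
  have [_ | _] := eqVneq i (col j); first by right; rewrite /mpar /= addrK.
  by case: eqP => _; [left | right].
by case: eqP => _; [left | right].
Qed.

Lemma mpar_act v : mvalid v.2 -> exists i, mpar v = mact i v.
Proof.
case: v => j [|x c] vv.
  by exists (col (j - 1)); rewrite /mact /= eq_sym (negbTE (col_ne j)) eqxx.
by exists ((rl j)^-1%g x); rewrite /mact /= permKV eqxx.
Qed.

Lemma madj_lmul v w : madj (mcoord v) (mcoord w) <-> exists i, w = lmul i v.
Proof.
split=> [|[i ->]]; last by rewrite mcoord_lmul; exact: mact_adj.
have inj x y : mcoord x = mcoord y -> x = y.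
  by move=> e; rewrite -(mcoordK x) e mcoordK.
case=> e; [have := mpar_act (mcoord_valid v) | have := mpar_act (mcoord_valid w)].
  by rewrite -e => -[i ei]; exists i; apply: inj; rewrite mcoord_lmul.
rewrite -e => -[i ei]; exists i; apply: inj.
by rewrite mcoord_lmul ei mactK // mcoord_valid.
Qed.

(** Depth plus offset along the geodesic is 1-Lipschitz and vanishes at [g i], which bounds the
    distance below; the walk along the geodesic and then along the word bounds it above. *)
Lemma tdist_geodesic v i :
  tdist v (g i) = (size (mcoord v).2 + `|((mcoord v).1 - i)%R|)%N.
Proof.
apply/eqP; rewrite eqn_leq; apply/andP; split; last first.
  pose phi w := (size (mcoord w).2)%:Z + `|(mcoord w).1 - i|.
  have := @tdist_lipschitz d phi v (g i) _; rewrite /phi mcoord_geodesic /=.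
  move=> h; apply: leq_trans (h _); first by clear; lia.
  move=> k w; rewrite mcoord_lmul; have := mact_adj k (mcoord w).
  exact: madj_distance.
rewrite tdist_sym.
have geo (j k : int) : (tdist (g k) (g j) <= `|(j - k)%R|)%N.
  have up (a : nat) (b : int) : (tdist (g b) (g (b + a%:Z)) <= a)%N.
    elim: a => [|a IH]; first by rewrite addr0; exact: (tdist_le (g b) [::]).
    by rewrite -addn1 PoszD addrA gcol addn1; apply: leq_trans (tdist_lmul _ _ _) _.
  have [le | lt] := leP k j.
    by have := up `|(j - k)%R|%N k; rewrite (_ : k + _ = j) //; lia.
  by rewrite tdist_sym; have := up `|(j - k)%R|%N j; rewrite (_ : j + _ = k) //; lia.
rewrite -{1}(mcoordK v) /mvertex; elim: (mcoord v).2 => [|x c IH] /=; first exact: geo.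
by apply: leq_trans (tdist_lmul _ _ _) _.
Qed.

Lemma geod_distE v : geod_dist g v = size (mcoord v).2.
Proof.
rewrite /geod_dist; case: ex_minnP => k /asboolP[j <-] /(_ (size (mcoord v).2)) h.
apply/eqP; rewrite eqn_leq tdist_geodesic leq_addr andbT -tdist_geodesic.
by apply: h; apply/asboolP; exists (mcoord v).1; rewrite tdist_geodesic subrr addn0.
Qed.

Lemma geod_projE v : geod_proj g v = g (mcoord v).1.
Proof.
rewrite /geod_proj; case: xgetP => [w _ [[j _ <-]]|/(_ (g (mcoord v).1))].
  by rewrite geod_distE tdist_geodesic => e; congr g; lia.
by case; split; [exists (mcoord v).1 | rewrite geod_distE tdist_geodesic subrr addn0].
Qed.

Lemma tdist_height v w : (`|((mcoord v).1 - (mcoord w).1)%R| <= tdist v w)%N.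
Proof.
apply: (@tdist_lipschitz d (fun w => (mcoord w).1)) => i u; rewrite mcoord_lmul.
have := mact_adj i (mcoord u) => h; have := mnear_fst (mnear_adj _ h).
by rewrite distnC => /(_ (mcoord u) 0%N); apply; exists 0%N, 0%N.
Qed.

Hypothesis rl_per : forall j j',
  col j = col j' -> col (j - 1) = col (j' - 1) -> rl j = rl j'.

Definition period (s : int) : Prop := forall j, col (j + s) = col j.

(** The relabelling depends only on the two colours of the geodesic at a point, so it is unchanged
    by a period. *)
Lemma mact_shift s i v : period s -> mact i (mshift s v) = mshift s (mact i v).
Proof.
move=> per; case: v => j c; rewrite /mact /mshift /=.
have cE : col (j + s - 1) = col (j - 1) by rewrite addrAC per.
have -> : rl (j + s) = rl j by apply: rl_per; rewrite ?per.
rewrite per cE; case: c => [|x c]; last by case: ifP.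
case: ifP => _ /=; first by congr pair; lia.
by case: ifP => _ //=; congr pair; lia.
Qed.

Lemma commuting_shift (theta : vertex d -> vertex d) s j :
  (forall i v, theta (lmul i v) = lmul i (theta v)) ->
  period s -> theta (g j) = g (j + s) ->
  forall v, mcoord (theta v) = mshift s (mcoord v).
Proof.
move=> th per e v; have [p _ <-] := tdist_walk (g j) v.
rewrite commuting_foldr // e; elim: p => [|i p IH] /=.
  by rewrite !mcoord_geodesic.
by rewrite !mcoord_lmul IH mact_shift.
Qed.

Hypothesis col_periodic : exists2 p : nat, (0 < p)%N & forall j, col (j + p%:Z) = col j.

(** Periodicity of the colours carries any index into the half-line without changing its colour. *)
Lemma periodic_extend s j0 :
  (forall j, j0 <= j -> col (j + s) = col j) \/
  (forall j, j <= j0 -> col (j + s) = col j) -> period s.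
Proof.
move=> h j; have [p p0 per] := col_periodic.
have perM (a : nat) i : col (i + (a * p)%N%:Z) = col i.
  elim: a i => [|a IH] i; first by rewrite mul0n addr0.
  by rewrite mulSn PoszD addrA IH per.
pose q := (`|(j - j0)%R| * p)%N; have leq : (`|(j - j0)%R| <= q)%N by exact: leq_pmulr.
case: h => h.
  rewrite -(perM `|(j - j0)%R|%N (j + s)) -(perM `|(j - j0)%R|%N j) addrAC.
  by apply: h; rewrite -/q; lia.
have := h (j - q%:Z); rewrite -(perM `|(j - j0)%R|%N (j - q%:Z)) -/q subrK.
rewrite -(perM `|(j - j0)%R|%N (j - q%:Z + s)) -/q addrAC subrK; apply.
by lia.
Qed.

(* A non-backtracking path that once moves away from the geodesic keeps doing
   so; a path with bounded distance therefore ends on the geodesic. *)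
Lemma bounded_path_axis (theta : vertex d -> vertex d) (c : nat -> 'I_d)
    (a : nat -> vertex d) (l D : nat) :
  (0 < l)%N -> (forall i v, theta (lmul i v) = lmul i (theta v)) ->
  (forall i, a i.+1 = lmul (c i) (a i)) -> (forall i, c i != c i.+1) ->
  (forall i, a (i + l)%N = theta (a i)) ->
  (forall i, (size (mcoord (a (i * l)%N)).2 <= D)%N) ->
  exists s : int, [/\ `|s|%N = l, period s &
    forall v, mcoord (theta v) = mshift s (mcoord v)].
Proof.
move=> l0 th aS cS al bnd.
have mS i : mcoord (a i.+1) = mact (c i) (mcoord (a i)) by rewrite aS mcoord_lmul.
(* After a step away from the geodesic only the letter just used leads back, and the next letter is
   different. *)
have up i : size (mcoord (a i.+1)).2 = (size (mcoord (a i)).2).+1 ->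
    size (mcoord (a i.+2)).2 = (size (mcoord (a i.+1)).2).+1.
  rewrite (mS i.+1) mS; case: (mcoord (a i)) => j [|x w]; rewrite /mact /=.
    case: ifP => // _; case: ifP => // _ _ /=.
    by rewrite (inj_eq perm_inj) eq_sym (negbTE (cS i)).
  case: ifP => /= _; first by move=> /eqP; rewrite -addn2 -[X in X == _]addn0 eqn_add2l.
  by move=> _; rewrite (inj_eq perm_inj) eq_sym (negbTE (cS i)).
(* Otherwise the depth would grow at every later step and exceed [D] at a multiple of [l]. *)
have noup i : size (mcoord (a i.+1)).2 <> (size (mcoord (a i)).2).+1.
  move=> hi; have ups t : size (mcoord (a (i.+1 + t)%N)).2 = (size (mcoord (a i)).2 + t.+1)%N /\
      size (mcoord (a (i.+2 + t)%N)).2 = (size (mcoord (a (i.+1 + t)%N)).2).+1.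
    elim: t => [|t [IH1 IH2]]; first by rewrite !addn0 addn1 hi; split=> //; rewrite -hi up.
    have -> : (i.+1 + t.+1 = i.+2 + t)%N by lia.
    have -> : (i.+2 + t.+1 = (i.+1 + t).+2)%N by lia.
    by split; [rewrite IH2 IH1 -addnS | exact: (up (i.+1 + t)%N IH2)].
  have := bnd (i.+1 + D.+1)%N.
  have := (ups ((i.+1 + D.+1) * l - i.+1)%N).1; rewrite subnKC; last by nia.
  by move=> ->; nia.
have down i : size (mcoord (a i.+1)).2 = (size (mcoord (a i)).2).-1.
  have := noup i; rewrite mS; case: (mcoord (a i)) => j [|x w]; rewrite /mact /=.
    by case: ifP => // _; case: ifP.
  by case: ifP.
(* The depth drops by one per step until it is 0, so the path is on the geodesic from time [i0]
   on. *)
pose i0 := size (mcoord (a 0%N)).2.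
have depth i : size (mcoord (a i)).2 = (i0 - i)%N.
  by elim: i => [|i IH]; rewrite ?subn0 // down IH subnS.
pose b t := (mcoord (a (i0 + t)%N)).1.
have ab t : a (i0 + t)%N = g (b t).
  have := depth (i0 + t)%N; rewrite subnDA subnn => /size0nil e.
  by rewrite -(mcoordK (a (i0 + t)%N)) /mvertex e.
have bstep t : (c (i0 + t)%N == col (b t)) && (b t.+1 == b t + 1) ||
    (c (i0 + t)%N == col (b t - 1)) && (b t.+1 == b t - 1).
  have := mS (i0 + t)%N; rewrite -addnS !ab !mcoord_geodesic /mact /=.
  case: ifP => [_ [->]|_]; first by rewrite eqxx.
  by case: ifP => [_ [->]|//]; rewrite eqxx orbT.
have cb t := cS (i0 + t)%N.
have cl i : c (i + l)%N = c i.
  apply: (@lmul_inj_letter _ _ _ (a (i + l)%N)).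
  by rewrite -aS -addSn al aS th al.
have thb t : theta (g (b t)) = g (b (t + l)%N) by rewrite -!ab addnA al.
(* On the geodesic, distinct consecutive letters forbid turning back, so the direction of the first
   step persists. *)
have [/andP[/eqP c0 /eqP b1] | /andP[/eqP c0 /eqP b1]] := orP (bstep 0%N).
  have dir t : c (i0 + t)%N = col (b t) /\ b t.+1 = b t + 1.
    elim: t => [|t [IH1 IH2]] //; have := cb t; rewrite IH1 -addnS.
    case/orP: (bstep t.+1) => /andP[/eqP e1 /eqP e2] //.
    by rewrite e1 IH2 addrK eqxx.
  have bE t : b t = b 0%N + t%:Z.
    by elim: t => [|t IH]; rewrite ?addr0 // (dir t).2 IH; lia.
  have bl t : b (t + l)%N = b t + l%:Z by rewrite (bE (t + l)%N) (bE t) PoszD addrA.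
  exists l%:Z; have per : period l%:Z.
    apply: (@periodic_extend _ (b 0%N)); left => j le_j.
    have -> : j = b `|(j - b 0%N)%R|%N by rewrite bE; lia.
    set t := `|_|%N; rewrite -bl.
    by rewrite -!(dir _).1 addnA cl.
  split=> //; apply: (commuting_shift th per (j := b 0%N)).
  by rewrite thb bl.
have dir t : c (i0 + t)%N = col (b t - 1) /\ b t.+1 = b t - 1.
  elim: t => [|t [IH1 IH2]] //; have := cb t; rewrite IH1 -addnS.
  case/orP: (bstep t.+1) => /andP[/eqP e1 /eqP e2] //.
  by rewrite e1 IH2 eqxx.
have bE t : b t = b 0%N - t%:Z.
  by elim: t => [|t IH]; rewrite ?subr0 // (dir t).2 IH; lia.
have bl t : b (t + l)%N = b t - l%:Z.
  by rewrite (bE (t + l)%N) (bE t) PoszD opprD addrA.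
exists (- l%:Z); have per : period (- l%:Z).
  apply: (@periodic_extend _ (b 0%N - 1)); right => j le_j.
  have -> : j = b `|(b 0%N - 1 - j)%R|%N - 1 by rewrite bE; lia.
  set t := `|_|%N; rewrite addrAC -bl.
  by rewrite -!(dir _).1 addnA cl.
split=> //; first by lia.
apply: (commuting_shift th per (j := b 0%N)).
by rewrite thb bl.
Qed.

Lemma supported_depth (m n : nat) (h : 'rV[int]_m -> vertex d) :
  supported_on n g h <-> forall x, (2 * size (mcoord (h x)).2 <= m * n)%N.
Proof.
have E x : ((geod_dist g (h x))%:R <= (m * n)%:R / 2 :> rat) =
    (2 * size (mcoord (h x)).2 <= m * n)%N.
  by rewrite ler_pdivlMr // -natrM ler_nat geod_distE mulnC.
by split=> H x; have := H x; rewrite E.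
Qed.

(** Let [q] be a shortest word from [h x] to its translate, where [x] has minimal displacement. If
    its first and last letters agreed, [hom_first_edge] would give a point of smaller displacement;
    so repetitions of [q] form a non-backtracking path at bounded distance, to which
    [bounded_path_axis] applies. Displacement 1 is excluded: it comes from an involution exchanging
    the ends of an edge. *)
Lemma hom_axis (m n : nat) (h : 'rV[int]_m -> vertex d) (k : 'I_m) :
  graph_hom h -> translation_invariant n h -> supported_on n g h ->
  min_shift_dist n h k <> 1%N ->
  exists s : int, [/\ `|s|%N = min_shift_dist n h k, period s &
    forall x, mcoord (h (x + e_ k *+ n)) = mshift s (mcoord (h x))].
Proof.
move=> hom inv /supported_depth depth; have [theta th hth] := translation_map k hom inv.
rewrite /min_shift_dist; case: ex_minnP => l /asboolP[x]; rewrite /lattice_shift hth => ex min_l l1.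
have {}min_l y : (l <= tdist (h y) (theta (h y)))%N.
  by rewrite -hth; apply: min_l; apply/asboolP; exists y.
have [l0 | l_gt0] := posnP l.
  exists 0; split=> [|j|y]; rewrite ?addr0 ?mshift0 ?l0 // hth; congr mcoord.
  apply: (@commuting_ext _ theta id (h x)) => //.
  by apply/esym/tdist0; rewrite ex.
have [q sq wq] := tdist_walk (h x) (theta (h x)); rewrite ex in sq.
have redq : reduced q by apply: (@geodesic_walk_reduced _ (h x)); rewrite wq ex sq.
have [y [z [q' qE]]] : exists y z q', q = y :: rcons q' z.
  case: q sq {wq redq} => [|y q]; first by move=> /= e; rewrite -e in l_gt0.
  case/lastP: q => [|q' z _]; last by exists y, z, q'.
  by move=> /= e; rewrite -e in l1.
have yz : z != y.
  apply/eqP => zy; have [u hu] : exists u, h u = lmul z (h x).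
    apply: (@hom_first_edge _ _ n _ k x z (y :: q')) => //; first by rewrite rcons_cons -qE.
    by rewrite hth -wq qE.
  have := min_l u; rewrite hu th -wq qE zy /= lmulK foldr_rcons.
  have := tdist_le (lmul y (h x)) q'; rewrite -sq qE /= size_rcons.
  by move: (tdist _ _) => t; lia.
(* Words act from the last letter, hence [rev q]; the path [a] follows its periodic repetition. *)
pose c i := nth z (rev q) (i %% l).
pose a i := nat_rect (fun _ : nat => vertex d) (h x) (fun i v => lmul (c i) v) i.
have cl i : c (i + l)%N = c i by rewrite /c modnDr.
have srq : size (rev q) = l by rewrite size_rev.
have a_take r : (r <= l)%N -> a r = foldl (fun v i => lmul i v) (h x) (take r (rev q)).
  elim: r => [|r IH] le_r; first by rewrite take0.
  rewrite (take_nth z) ?srq // -cats1 foldl_cat -IH; last exact: ltnW.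
  by rewrite /= /c modn_small.
have al : a l = theta (h x) by rewrite a_take // -srq take_size foldl_rev.
have [s [sl per hs]] : exists s : int, [/\ `|s|%N = l, period s &
    forall v, mcoord (theta v) = mshift s (mcoord v)].
  have aal i : a (i + l)%N = theta (a i).
    by elim: i => [|i IH] //; rewrite addSn /= -/(a _) IH cl th.
  apply: (@bounded_path_axis theta c a l (m * n)) => //.
  - move=> i; rewrite /c; have lt_i := ltn_pmod i l_gt0.
    have [lt | ge] := ltnP (i %% l).+1 l.
      have -> : (i.+1 %% l = (i %% l).+1)%N by rewrite -addn1 -modnDml addn1 modn_small.
      have : sorted (fun i j => i != j) (rev q).
        by rewrite rev_sorted; apply: sub_sorted redq => u v; rewrite eq_sym.
      by move/(sortedP z)/(_ (i %% l)%N); rewrite srq; apply.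
    have e : ((i %% l).+1 = l)%N by lia.
    have -> : (i.+1 %% l = 0)%N by rewrite -addn1 -modnDml addn1 e modnn.
    rewrite nth_rev sq ?e // subnn qE /= rev_cons rev_rcons /=.
    by rewrite eq_sym.
  move=> i; apply: leq_trans (_ : 2 * size (mcoord (a (i * l)%N)).2 <= _)%N.
    by rewrite leq_pmull.
  have -> : a (i * l)%N = h (x + e_ k *+ n *+ i); last exact: depth.
  elim: i => [|i IH]; first by rewrite mul0n mulr0n addr0.
  by rewrite mulSn addnC aal IH -hth -addrA -mulrSr.
by exists s; split=> // u; rewrite hth hs.
Qed.

Lemma mcoord_inj : injective mcoord.
Proof. by move=> x y e; rewrite -(mcoordK x) e mcoordK. Qed.

Lemma geodesic_inj : injective g.
Proof. by move=> i j /(congr1 mcoord); rewrite !mcoord_geodesic => -[]. Qed.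

Lemma origin_condition (v : vertex d) :
  (geod_proj g v = if odd (tdist v (geod_proj g v)) then g 1 else g 0) <->
  (mcoord v).1 = odd (size (mcoord v).2).
Proof.
rewrite geod_projE tdist_geodesic subrr addn0.
by case: (odd _); split=> [/geodesic_inj|->].
Qed.

(** The signs are those of the translations found by [hom_axis]. The facts on floors and periods
    follow from the existence of one [h] and feed the converse [mslope_Hset]. *)
Lemma Hset_mslope (R : realType) (m n : nat) (s : 'rV[R]_m) (h : 'rV[int]_m -> vertex d) :
  (0 < n)%N -> (forall k, floor_nat s n k <> 1%N) -> Hset g s n h ->
  mslope_set n (floor_nat s n) (mcoord \o h) /\
  forall k, 0 <= Num.floor (s 0 k * n%:R) /\ period (floor_nat s n k)%:Z.
Proof.
move=> n0 ne1 hh; have [hom inv _ supp orig] := hh.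
have floorE k := Hset_floor k n0 hh.
have slopeE k : floor_nat s n k = min_shift_dist n h k by rewrite /floor_nat floorE.
have /choice[t ht] : forall k, exists t : int, [/\ `|t|%N = floor_nat s n k, period t &
    forall x, mcoord (h (x + e_ k *+ n)) = mshift t (mcoord (h x))].
  by move=> k; rewrite slopeE; apply: hom_axis => //; rewrite -slopeE.
have tE k : t k = signz (t k < 0) (floor_nat s n k).
  by have [<- _ _] := ht k; rewrite /signz; case: ltP; lia.
split.
  exists [ffun k => t k < 0]; split.
  - by move=> x k; apply/madj_lmul; exact: (graph_homP h).1.
  - by move=> x; exact: mcoord_valid.
  - by move=> x k; rewrite ffunE -tE; have [_ _ /(_ x)] := ht k.
  - exact/supported_depth.
  - exact/origin_condition.
move=> k; split; first by rewrite floorE.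
have [<- per _] := ht k; have [t0 | t0] := leP 0 (t k); first by rewrite gez0_abs.
by move=> j; rewrite ltz0_abs //; have := per (j - t k); rewrite subrK.
Qed.

Lemma mslope_Hset (R : realType) (m n : nat) (s : 'rV[R]_m) (H : 'rV[int]_m -> mvert d) :
  (0 < n)%N -> (forall k, 0 <= Num.floor (s 0 k * n%:R)) ->
  (forall k, period (floor_nat s n k)%:Z) ->
  mslope_set n (floor_nat s n) H -> Hset g s n (mvertex \o H).
Proof.
move=> n0 fl0 per [eps [homH valH shiftH depthH origH]].
have HK x : mcoord (mvertex (H x)) = H x by apply: mvertexK; exact: valH.
have pert k : period (signz (eps k) (floor_nat s n k)).
  rewrite /signz; case: (eps k) => //; move=> j.
  by rewrite -(per k (j - _)) subrK.
have hom : graph_hom (mvertex \o H).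
  by apply/graph_homP => x k; apply/madj_lmul; rewrite /= !HK.
have msd k : min_shift_dist n (mvertex \o H) k = floor_nat s n k.
  rewrite /min_shift_dist; case: ex_minnP => l /asboolP[x <-].
  rewrite /lattice_shift /= => min_l.
  apply/eqP; rewrite eqn_leq; apply/andP; split; last first.
    apply: leq_trans (tdist_height _ _); rewrite !HK shiftH /= /signz.
    by case: (eps k); lia.
  apply: min_l; apply/asboolP.
  have [l0 | l_gt0] := posnP (floor_nat s n k).
    exists 0; rewrite /lattice_shift /= shiftH l0 /signz; case: (eps k).
      by rewrite oppr0 mshift0; apply/eqP; rewrite -leqn0; exact: (tdist_le _ [::]).
    by rewrite mshift0; apply/eqP; rewrite -leqn0; exact: (tdist_le _ [::]).
  (* Along the line from 0 to its translate the foot on the geodesic must change, which happens only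
     at depth 0; there the displacement equals the translation length. *)
  have [u _] : exists2 t, (t < n)%N & ((H (e_ k *+ t)).1 == (H 0).1) !=
      ((H (e_ k *+ t.+1)).1 == (H 0).1).
    apply: bool_crossing; rewrite mulr0n eqxx -[e_ k *+ n]add0r shiftH /=.
    have -> : ((H 0).1 + signz (eps k) (floor_nat s n k) == (H 0).1) = false.
      by apply/eqP; rewrite /signz; case: (eps k); lia.
    by [].
  rewrite mulrSr; set y := e_ k *+ u => neq.
  have Hy : (H y).2 = [::].
    have := homH y k; case: (H y) (H (y + e_ k)) neq => j [|i w] [j' [|i' w']] //= neq;
      by case; rewrite /mpar /= => -[] // ej; move: neq; rewrite ej ?eqxx.
  exists y; rewrite /lattice_shift /= shiftH /mshift Hy /mvertex /= Hy /=.
  rewrite tdist_geodesic mcoord_geodesic /= /signz.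
  by case: (eps k); lia.
split=> //.
- move=> x y adj k; have [i hi] := (tdist1P _ _).1 (hom x y adj).
  rewrite /dual_map hi colour_lmul /lattice_shift; apply/esym.
  have -> : (mvertex \o H) (y + e_ k *+ n) = lmul i ((mvertex \o H) (x + e_ k *+ n)).
    apply: mcoord_inj; rewrite mcoord_lmul /= !HK !shiftH mact_shift //.
    by congr mshift; have := congr1 mcoord hi; rewrite mcoord_lmul /= !HK.
  exact: colour_lmul.
- apply/rowP => k; rewrite !mxE msd /floor_nat natr_absz ger0_norm //.
- by apply/supported_depth => x; rewrite /= HK.
by apply/origin_condition; rewrite /= HK.
Qed.

Lemma Hset_count (R : realType) (m n : nat) (s : 'rV[R]_m) :
  (0 < n)%N -> (forall k, floor_nat s n k <> 1%N) -> Hset g s n !=set0 ->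
  @mslope_set m d n (floor_nat s n) !=set0 /\
  counting (Hset g s n) = (mcount d n (floor_nat s n))%:R%:E :> \bar R.
Proof.
move=> n0 ne1 [h0 hh0]; have [ms0 hk] := Hset_mslope n0 ne1 hh0.
split; first by exists (mcoord \o h0).
have [e [inj_e eP]] := mcount_enum d (floor_nat s n) n0.
have eH i : mslope_set n (floor_nat s n) (e i) by apply/eP; exists i.
have eK i x : mcoord (mvertex (e i x)) = e i x.
  by have [eps [_ v _ _ _]] := eH i; exact: mvertexK.
apply: (@enumerates_counting _ _ _ _ (fun i => mvertex \o e i)); split.
  move=> i j ij; apply: inj_e; apply/funext => x.
  by rewrite -eK -[RHS]eK; congr mcoord; have := congr1 (fun f => f x) ij.
move=> h; split=> [hh | [i ->]].
  have [/eP[i hi] _] := Hset_mslope n0 ne1 hh; exists i.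
  by apply/funext => x /=; rewrite -hi /= mcoordK.
by apply: mslope_Hset => // k; have [] := hk k.
Qed.

End Coordinates.

(** * Transfer of the limit from the model to [ent] *)

Lemma geodesic_colours (d : nat) (g : int -> vertex d) :
  two_sided_geodesic g -> periodic_geodesic g ->
  exists col : int -> 'I_d, exists rl : int -> {perm 'I_d},
    [/\ forall j, g (j + 1) = lmul (col j) (g j),
      forall j, col j != col (j - 1),
      forall j i, (rl j i < 2)%N = (i == col j) || (i == col (j - 1)),
      forall j j', col j = col j' -> col (j - 1) = col (j' - 1) -> rl j = rl j' &
      exists2 p : nat, (0 < p)%N & forall j, col (j + p%:Z) = col j].
Proof.
move=> [inj_g adj] [p p0 per].
have /choice[col hcol] : forall j, exists i, g (j + 1) = lmul i (g j).
  by move=> j; apply/tdist1P/adj; rewrite opprD addNKr normrN1.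
have col_ne j : col j != col (j - 1).
  apply/eqP => e; have := hcol j; have := hcol (j - 1); rewrite subrK e => ->.
  by rewrite lmulK => /inj_g; lia.
(* The relabelling is chosen per pair of colours, so equal pairs get equal relabellings. *)
have /choice[r hr] : forall ab : 'I_d * 'I_d, exists s : {perm 'I_d}, ab.1 != ab.2 ->
    forall i, (s i < 2)%N = (i == ab.1) || (i == ab.2).
  move=> ab; have [ne | eq] := boolP (ab.1 != ab.2); last by exists 1%g.
  by have [s hs] := relabel_ex ne; exists s.
exists col, (fun j => r (col j, col (j - 1))); split=> //.
- by move=> j i; apply: hr; exact: col_ne.
- by move=> j j' -> ->.
exists p => // j; have := per j; rewrite !hcol !colour_lmul => -[].
by [].
Qed.

(** A zero coordinate has floor 0 and a positive one eventually has floor at least 2, so the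
    exceptional displacement of [hom_axis] is avoided. *)
Lemma floor_nat_neq1 (R : realType) (m : nat) (s : 'rV[R]_m) :
  (forall k, 0 <= s 0 k) ->
  \forall n \near \oo, forall k, floor_nat s n k <> 1%N.
Proof.
move=> s0; apply: filter_forall => k; have [sk0 | sk_neq0] := eqVneq (s 0 k) 0.
  by apply: nearW => n; rewrite /floor_nat sk0 mul0r floor0.
have sk : 0 < s 0 k by rewrite lt_neqAle eq_sym sk_neq0 s0.
have [n0 hn0] := nat_above (2 / s 0 k); exists n0 => // n /= /hn0.
rewrite ler_pdivrMr // mulrC => le2 e1; have /andP[_] := floor_natP n (s0 k).
by rewrite e1; lra.
Qed.

Lemma ent_cvg (R : realType) (m d : nat) (s : 'rV[R]_m) (g : int -> vertex d) (L : R) :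
  two_sided_geodesic g -> periodic_geodesic g -> g 0 = tree_root d ->
  (forall k, 0 <= s 0 k) ->
  (forall eta, 0 < eta -> exists n0, forall n, (n0 <= n)%N -> madmissible d s n ->
     `|mentropy d s n - L| < eta) ->
  ent g s @ within (admissible g s) \oo --> (- L)%:E.
Proof.
move=> geod per g0 s0 hL.
have [col [rl [gcol col_ne rl_lt rl_per col_per]]] := geodesic_colours geod per.
have count : \forall n \near \oo, admissible g s n ->
    madmissible d s n /\ (- mentropy d s n)%:E = ent g s n.
  near=> n => adm.
  have n0 : (0 < n)%N by near: n; exists 1%N.
  have ne1 : forall k, floor_nat s n k <> 1%N by near: n; exact: floor_nat_neq1.
  have [madm cnt] := Hset_count gcol col_ne g0 rl_lt rl_per col_per n0 ne1 adm.
  split=> //; rewrite /ent cnt /= ifN; last first.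
    by rewrite -ltNge ltr0n mcount_gt0.
  by rewrite -EFinM -EFinN /mentropy mulrC.
apply: (@cvg_trans _ ((fun n => (- mentropy d s n)%:E) @ within (admissible g s) \oo)).
  apply: near_eq_cvg; rewrite /prop_near1 /=.
  by apply: filterS count => n h /h[].
apply/fine_cvgP; split; first by apply: nearW.
apply/cvgrPdist_lt => eta eta0; have [n0 hn0] := hL eta eta0.
have near0 : \forall n \near \oo, (n0 <= n)%N by exists n0.
apply: filterS (filterI count near0) => n [cnt le_n] adm /=.
by rewrite opprK addrC; apply: hn0 => //; exact: (cnt adm).1.
Unshelve. all: by end_near.
Qed.

Theorem theorem3p8 (R : realType) (m d : nat) (hm : (2 <= m)%N) :
  exists entper : 'rV[R]_m -> R,
    (forall s : 'rV[R]_m, l1norm s < 1 ->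
       forall g : int -> vertex d,
         two_sided_geodesic g -> periodic_geodesic g -> g 0 = tree_root d ->
         ent g s @ within (admissible g s) \oo --> (entper s)%:E) /\
    (forall s : 'rV[R]_m, l1norm s = 1 -> entper s = 0).
Proof.
(* [L] comes from the model counts before any [g] is introduced, so one limit serves all
   geodesics. *)
have /choice[L hL] : forall s : 'rV[R]_m, exists L : R, l1norm s < 1 ->
    (forall k, 0 <= s 0 k) -> forall eta, 0 < eta -> exists n0, forall n,
    (n0 <= n)%N -> madmissible d s n -> `|mentropy d s n - L| < eta.
  move=> s; have [[s1 s0] | no] := pselect (l1norm s < 1 /\ forall k, 0 <= s 0 k).
    by have [L hL] := mentropy_limit d hm s0 s1; exists L.
  by exists 0 => s1 s0; case: no.
exists (fun s => if l1norm s < 1 then - L s else 0); split; last first.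
  by move=> s ->; rewrite ltxx.
move=> s s1 g geod per g0; rewrite s1.
have [s0 | /existsNP[k neg]] := pselect (forall k, 0 <= s 0 k).
  exact: ent_cvg (hL s s1 s0).
(* A negative coordinate has a negative floor, which is no distance; no positive [n] is admissible
   and the convergence is vacuous. *)
move=> A _; exists 1%N => // n /= n0 [h hh]; exfalso; apply: neg.
rewrite -(pmulr_lge0 _ (_ : 0 < n%:R)) ?ltr0n // -floor_ge0.
by rewrite (Hset_floor k n0 hh).
Qed.
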